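(* Let $b_+,b_->0$, $\delta_\pm\in\mathbb R$ with $b_\pm+\delta_\pm>0$ and $\delta_+\delta_-<0$, and $c>0$. Then there is a nonzero real constant $E^{(1)}_{\mathrm{II}}$, determined by $(b_\pm,\delta_\pm,c)$, such that for all sufficiently small but nonzero $|k|$ the type-II interface Hamiltonian $\hat H_{\mathrm{II}}(k)$ (defined in the context) has two distinct eigenvalues $E_{\mathrm{II},+}(k)$, $E_{\mathrm{II},-}(k)$ satisfying $$E_{\mathrm{II},\pm}(k)=\pm E^{(1)}_{\mathrm{II}}|k|+\mathcal O(k^2).$$
   Context: Coefficients: for $n\in\mathbb Z$ let $b_n=b_+$ for $n\ge0$ and $b_n=b_-$ for $n\le-1$; $c_n=b_++\delta_+$ for $n\ge0$, $c_{-1}=c$, $c_n=b_-+\delta_-$ for $n\le-2$; $d_n=b_++\delta_+$ for $n\ge0$, $d_{-1}=d_{-2}=c$, $d_n=b_-+\delta_-$ for $n\le-3$. For $k\in[-\pi,\pi)$, $\hat H_{\mathrm{II}}(k)$ is the bounded self-adjoint operator on $\ell^2(\mathbb Z;\mathbb C^6)$ acting on $w=\{(w_{j,n})_{j=1}^6\}_{n\in\mathbb Z}$ by $(\hat H_{\mathrm{II}}(k)w)_{1,n}=-b_nw_{4,n}-b_nw_{5,n}-c_ne^{-ik}w_{6,n+1}$, $(\hat H_{\mathrm{II}}(k)w)_{2,n}=-b_nw_{4,n}-d_{n-2}e^{ik}w_{5,n-2}-b_nw_{6,n}$, $(\hat H_{\mathrm{II}}(k)w)_{3,n}=-c_nw_{4,n+1}-b_nw_{5,n}-b_nw_{6,n}$,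 $(\hat H_{\mathrm{II}}(k)w)_{4,n}=-b_nw_{1,n}-b_nw_{2,n}-c_{n-1}w_{3,n-1}$, $(\hat H_{\mathrm{II}}(k)w)_{5,n}=-b_nw_{1,n}-d_ne^{-ik}w_{2,n+2}-b_nw_{3,n}$, $(\hat H_{\mathrm{II}}(k)w)_{6,n}=-c_{n-1}e^{ik}w_{1,n-1}-b_nw_{2,n}-b_nw_{3,n}$. *)

(* Defs.v *)
From Stdlib Require Import Reals ZArith.
From Coquelicot Require Import Coquelicot.
Open Scope R_scope.

Definition coef_b (bp bm : R) (n : Z) : R :=
  if Z.leb 0 n then bp else bm.

Definition coef_c (bp bm dp dm c : R) (n : Z) : R :=
  if Z.leb 0 n then bp + dp
  else if Z.eqb n (-1) then c
  else bm + dm.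

Definition coef_d (bp bm dp dm c : R) (n : Z) : R :=
  if Z.leb 0 n then bp + dp
  else if Z.leb (-2) n then c
  else bm + dm.

Definition cexpi (k : R) : C := (cos k, sin k).

(* A vector w in C^6-valued sequences: w j n = w_{j,n}, components j = 1..6. *)
Definition vec := nat -> Z -> C.

Definition H_II (bp bm dp dm c k : R) (w : vec) : vec :=
  fun j n =>
  let b := fun m => RtoC (coef_b bp bm m) in
  let cc := fun m => RtoC (coef_c bp bm dp dm c m) in
  let d := fun m => RtoC (coef_d bp bm dp dm c m) in
  match j with
  | 1%nat => Copp (Cplus (Cplus (Cmult (b n) (w 4%nat n)) (Cmult (b n) (w 5%nat n)))
                        (Cmult (Cmult (cc n) (cexpi (- k))) (w 6%nat (n + 1)%Z)))
  | 2%nat => Copp (Cplus (Cplus (Cmult (b n) (w 4%nat n))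
                               (Cmult (Cmult (d (n - 2)%Z) (cexpi k)) (w 5%nat (n - 2)%Z)))
                        (Cmult (b n) (w 6%nat n)))
  | 3%nat => Copp (Cplus (Cplus (Cmult (cc n) (w 4%nat (n + 1)%Z)) (Cmult (b n) (w 5%nat n)))
                        (Cmult (b n) (w 6%nat n)))
  | 4%nat => Copp (Cplus (Cplus (Cmult (b n) (w 1%nat n)) (Cmult (b n) (w 2%nat n)))
                        (Cmult (cc (n - 1)%Z) (w 3%nat (n - 1)%Z)))
  | 5%nat => Copp (Cplus (Cplus (Cmult (b n) (w 1%nat n))
                               (Cmult (Cmult (d n) (cexpi (- k))) (w 2%nat (n + 2)%Z)))
                        (Cmult (b n) (w 3%nat n)))
  | 6%nat => Copp (Cplus (Cplus (Cmult (Cmult (cc (n - 1)%Z) (cexpi k)) (w 1%nat (n - 1)%Z))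
                               (Cmult (b n) (w 2%nat n)))
                        (Cmult (b n) (w 3%nat n)))
  | _ => RtoC 0
  end.

Definition valid_index (j : nat) : Prop := (1 <= j <= 6)%nat.

Definition in_l2 (w : vec) : Prop :=
  forall j, valid_index j ->
    ex_series (fun m : nat => (Cmod (w j (Z.of_nat m))) ^ 2) /\
    ex_series (fun m : nat => (Cmod (w j (- Z.of_nat m - 1)%Z)) ^ 2).

Definition nonzero_vec (w : vec) : Prop :=
  exists j n, valid_index j /\ w j n <> RtoC 0.

Definition is_eigenvalue_II (bp bm dp dm c k E : R) : Prop :=
  exists w : vec, in_l2 w /\ nonzero_vec w /\
    forall j n, valid_index j ->
      H_II bp bm dp dm c k w j n = Cmult (RtoC E) (w j n).

(* Main.v *)
(** After the gauge change [w_{j,n} -> exp(i k n / 2) w_{j,n}], the ansatz [w_6 = conj w_4],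
    [w_3 = conj w_1] with [w_2] and [w_5] real turns the eigenvalue problem into a real one.
    At [k = E = 0] it splits into two-step difference operators and their adjoints; the
    reflection [n -> -1 - n] exchanges the two half-planes, so one may take [dp > 0 > dm], and
    then there are two decaying zero modes with components of constant sign, one in [Im w_4] and
    one in [(Re w_1, w_2)].  For small parameters all equations but two are solved, for
    prescribed values of [Im w_4] and [Re w_1] at [n = 0], by a Neumann series in a sup norm with
    exponential weights.
    Pairing with the zero modes shows that the two remaining defects are given by the matrix
    [((E N1, s t), (s t, E N2)) + O(E^2 + s^2)], with [s = sin (k / 2)] and positive constants
    [N1], [N2], [t]; the intermediate value theorem, applied to its determinant, gives the
    eigenvalue [E = t / sqrt (N1 N2) |s| + O(s^2)], and chiral symmetry gives [-E]. *)

Require Import Defs.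
From Stdlib Require Import Reals ZArith Lra Lia Ranalysis5.
From Coquelicot Require Import Coquelicot.
From Stdlib Require Import List.
Import ListNotations.
Open Scope R_scope.

Lemma Series_nonneg (u : nat -> R) : ex_series u -> (forall m, 0 <= u m) -> 0 <= Series u.
Proof.
  intros Hu Hpos. rewrite <- (Rmult_0_l (Series u)), <- Series_scal_l.
  apply Series_le; [|trivial]. intros m. specialize (Hpos m). lra.
Qed.

Lemma continuity_pt_lipschitz f x r L : 0 < r -> 0 <= L ->
  (forall y, Rabs (y - x) < r -> Rabs (f y - f x) <= L * Rabs (y - x)) -> continuity_pt f x.
Proof.
  intros Hr HL Hf eps Heps. exists (Rmin r (eps / (L + 1))). split.
  - apply Rmin_glb_lt; [trivial|]. apply Rdiv_lt_0_compat; lra.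
  - intros y [_ Hy]. simpl in *. unfold Rdist in *.
    assert (Hy1 := Rlt_le_trans _ _ _ Hy (Rmin_l _ _)).
    assert (Hy2 := Rlt_le_trans _ _ _ Hy (Rmin_r _ _)).
    apply Rlt_div_r in Hy2; [|lra]. assert (H := Rabs_pos (y - x)).
    apply Rle_lt_trans with (1 := Hf y Hy1). lra.
Qed.

(** * Neumann series of row-finite matrices *)

Definition follows_sign (s x : R) : Prop := 0 <= s * x /\ (s = 0 -> x = 0).

Lemma follows_sign_mul_0 t a : follows_sign t (a * 0).
Proof. rewrite Rmult_0_r. split; [lra|trivial]. Qed.

Lemma follows_sign_pos_mul_1 a : 0 <= a -> follows_sign 1 (a * 1).
Proof. intros Ha. split; lra. Qed.

Lemma follows_sign_neg_mul_1 a : 0 <= a -> follows_sign (-1) (- a * 1).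
Proof. intros Ha. split; lra. Qed.

Lemma follows_sign_Series s (u : nat -> R) : ex_series u ->
  (forall m, follows_sign s (u m)) -> follows_sign s (Series u).
Proof.
  intros Hu Hs. split.
  - rewrite <- Series_scal_l. apply Series_nonneg; [|intros m; apply Hs].
    now apply (ex_series_scal (K := R_AbsRing) (V := R_NormedModule) s u).
  - intros H0. rewrite (Series_ext u (fun m => 0 * u m)), Series_scal_l; [ring|].
    intros m. rewrite (proj2 (Hs m) H0). ring.
Qed.

Section RowFinite.

Context {I : Type}.

Definition row : Type := list (R * I).

Definition row_eval (r : row) (x : I -> R) : R :=
  fold_right (fun e s => fst e * x (snd e) + s) 0 r.

Definition row_norm (W : I -> R) (r : row) : R :=
  fold_right (fun e s => Rabs (fst e) * W (snd e) + s) 0 r.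

Definition row_scale (a : R) (r : row) : row := map (fun e => (a * fst e, snd e)) r.

Definition wbounded (W : I -> R) (M : R) (x : I -> R) : Prop :=
  forall i, Rabs (x i) <= M * W i.

Lemma row_eval_app r r' x : row_eval (r ++ r') x = row_eval r x + row_eval r' x.
Proof. induction r as [|e r IH]; simpl; [|rewrite IH]; ring. Qed.

Lemma row_eval_scale a r x : row_eval (row_scale a r) x = a * row_eval r x.
Proof. induction r as [|e r IH]; simpl; [|rewrite IH]; ring. Qed.

Lemma row_eval_linear r a b x y :
  row_eval r (fun i => a * x i + b * y i) = a * row_eval r x + b * row_eval r y.
Proof. induction r as [|e r IH]; simpl; [|rewrite IH]; ring. Qed.

Lemma row_eval_minus r x y :
  row_eval r (fun i => x i - y i) = row_eval r x - row_eval r y.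
Proof. induction r as [|e r IH]; simpl; [|rewrite IH]; ring. Qed.

Lemma row_norm_app W r r' : row_norm W (r ++ r') = row_norm W r + row_norm W r'.
Proof. induction r as [|e r IH]; simpl; [|rewrite IH]; ring. Qed.

Lemma row_norm_scale W a r : row_norm W (row_scale a r) = Rabs a * row_norm W r.
Proof. induction r as [|e r IH]; simpl; [|rewrite IH, Rabs_mult]; ring. Qed.

Lemma Rabs_row_eval W M r x : wbounded W M x -> Rabs (row_eval r x) <= M * row_norm W r.
Proof.
  intros Hx. induction r as [|[a i] r IH]; simpl.
  - rewrite Rabs_R0. lra.
  - apply Rle_trans with (1 := Rabs_triang _ _). rewrite Rabs_mult.
    assert (Rabs a * Rabs (x i) <= Rabs a * (M * W i))
      by (apply Rmult_le_compat_l; [apply Rabs_pos|apply Hx]).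
    lra.
Qed.

Lemma row_eval_Series r (u : nat -> I -> R) :
  (forall i, ex_series (fun m => u m i)) ->
  is_series (fun m => row_eval r (u m)) (row_eval r (fun i => Series (fun m => u m i))).
Proof.
  intros Hu. induction r as [|[a i] r IH]; simpl.
  - apply filterlim_ext with (fun _ => 0); [|apply filterlim_const].
    intros n. rewrite sum_n_const. ring.
  - apply (is_series_plus (fun m => a * u m i)); [|exact IH].
    apply (is_series_scal (K := R_AbsRing) (V := R_NormedModule) a).
    apply Series_correct, Hu.
Qed.

Lemma continuity_pt_row_eval r (x : R -> I -> R) t :
  (forall i, continuity_pt (fun t => x t i) t) -> continuity_pt (fun t => row_eval r (x t)) t.
Proof.
  intros Hx. induction r as [|[a i] r IH]; simpl.
  - now apply continuity_pt_const.
  - apply continuity_pt_plus; [|exact IH]. now apply (continuity_pt_scal (fun t => x t i) a).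
Qed.

Lemma row_eval_follows_sign s (sigma : I -> R) r x :
  (forall i, follows_sign (sigma i) (x i)) ->
  Forall (fun e => follows_sign s (fst e * sigma (snd e))) r ->
  follows_sign s (row_eval r x).
Proof.
  intros Hx Hr. induction Hr as [|[a i] r [Ha Ha0] _ [IH IH0]]; simpl in *.
  - split; [lra|trivial].
  - destruct (Hx i) as [Hxi Hxi0].
    destruct (Req_dec (sigma i) 0) as [Hi|Hi].
    + rewrite (Hxi0 Hi), Rmult_0_r, Rplus_0_l. now split.
    + split.
      * rewrite Rmult_plus_distr_l. apply Rplus_le_le_0_compat; [|exact IH].
        apply Rmult_le_reg_l with (sigma i ^ 2); [now apply pow2_gt_0|].
        rewrite Rmult_0_r.
        replace (sigma i ^ 2 * (s * (a * x i))) with (s * (a * sigma i) * (sigma i * x i)) by ring.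
        now apply Rmult_le_pos.
      * intros Hs. rewrite (IH0 Hs). specialize (Ha0 Hs).
        apply Rmult_integral in Ha0. destruct Ha0 as [-> | H]; [ring|contradiction].
Qed.

Section Neumann.

Variables (W : I -> R) (T : I -> row) (lam : R).
Hypotheses (W_nonneg : forall i, 0 <= W i) (lam_range : 0 <= lam < 1)
  (T_contracts : forall i, row_norm W (T i) <= lam * W i).

Lemma row_eval_contracts M x : 0 <= M -> wbounded W M x ->
  wbounded W (lam * M) (fun i => row_eval (T i) x).
Proof.
  intros HM Hx i. apply Rle_trans with (1 := Rabs_row_eval _ _ _ _ Hx).
  rewrite (Rmult_comm lam), Rmult_assoc. now apply Rmult_le_compat_l.
Qed.

Lemma wbounded_fixed_point eta M g x : 0 <= eta -> 0 <= M ->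
  wbounded W M x -> wbounded W eta g ->
  (forall i, x i = g i + row_eval (T i) x) ->
  wbounded W (eta / (1 - lam)) x.
Proof.
  intros Heta HM Hx Hg Hfix.
  set (q := eta / (1 - lam)).
  assert (Hq : 0 <= q) by (apply Rdiv_le_0_compat; lra).
  assert (iterated : forall m, wbounded W (lam ^ m * M + q) x).
  { induction m as [|m IH]; intros i.
    - apply Rle_trans with (1 := Hx i). apply Rmult_le_compat_r; [apply W_nonneg|].
      simpl. lra.
    - assert (Hm : 0 <= lam ^ m * M + q)
        by (apply Rplus_le_le_0_compat; [apply Rmult_le_pos; [apply pow_le|]|]; lra).
      rewrite Hfix. apply Rle_trans with (1 := Rabs_triang _ _).
      replace ((lam ^ S m * M + q) * W i) with (eta * W i + lam * (lam ^ m * M + q) * W i)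
        by (unfold q; simpl; field; lra).
      apply Rplus_le_compat; [apply Hg|exact (row_eval_contracts _ _ Hm IH i)]. }
  intros i.
  assert (lim_pow : is_lim_seq (fun m => lam ^ m) 0)
    by (apply is_lim_seq_geom; rewrite Rabs_pos_eq; lra).
  apply (is_lim_seq_le (fun _ => Rabs (x i)) (fun m => lam ^ m * (M * W i) + q * W i)
           (Rabs (x i)) (q * W i)).
  - intros m. apply Rle_trans with (1 := iterated m i). lra.
  - apply is_lim_seq_const.
  - replace (Finite (q * W i)) with (Finite (0 * (M * W i) + q * W i)) by (f_equal; ring).
    apply is_lim_seq_plus'; [|apply is_lim_seq_const].
    apply is_lim_seq_mult'; [exact lim_pow|apply is_lim_seq_const].
Qed.

Variables (f : I -> R) (M : R).
Hypotheses (M_nonneg : 0 <= M) (f_bounded : wbounded W M f).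

Fixpoint neumann_term (m : nat) : I -> R :=
  match m with
  | O => f
  | S m' => fun i => row_eval (T i) (neumann_term m')
  end.

Definition neumann : I -> R := fun i => Series (fun m => neumann_term m i).

Lemma wbounded_neumann_term m : wbounded W (lam ^ m * M) (neumann_term m).
Proof.
  induction m as [|m IH].
  - simpl. now rewrite Rmult_1_l.
  - simpl pow. rewrite Rmult_assoc. apply row_eval_contracts; [|exact IH].
    apply Rmult_le_pos; [apply pow_le|]; lra.
Qed.

Lemma is_series_geom_scal a : is_series (fun m => lam ^ m * a) (/ (1 - lam) * a).
Proof.
  apply (is_series_scal_r a). apply is_series_geom. rewrite Rabs_pos_eq; lra.
Qed.

Lemma ex_series_Rabs_neumann_term i : ex_series (fun m => Rabs (neumann_term m i)).
Proof.
  apply (ex_series_le (V := R_CompleteNormedModule)) with (fun m => lam ^ m * (M * W i)).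
  - intros m. change (norm ?z) with (Rabs z). rewrite Rabs_Rabsolu, <- Rmult_assoc.
    apply wbounded_neumann_term.
  - eexists. apply is_series_geom_scal.
Qed.

Lemma ex_series_neumann_term i : ex_series (fun m => neumann_term m i).
Proof. apply ex_series_Rabs, ex_series_Rabs_neumann_term. Qed.

Lemma neumann_fixed_point i : neumann i = f i + row_eval (T i) neumann.
Proof.
  unfold neumann at 1. rewrite Series_incr_1 by apply ex_series_neumann_term.
  apply Rplus_eq_compat_l, is_series_unique, row_eval_Series, ex_series_neumann_term.
Qed.

Lemma wbounded_neumann : wbounded W (M / (1 - lam)) neumann.
Proof.
  intros i. apply Rle_trans with (1 := Series_Rabs _ (ex_series_Rabs_neumann_term i)).
  replace (M / (1 - lam) * W i) with (/ (1 - lam) * (M * W i)) by (unfold Rdiv; ring).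
  rewrite <- (is_series_unique _ _ (is_series_geom_scal (M * W i))).
  apply Series_le; [|eexists; apply is_series_geom_scal].
  intros m. split; [apply Rabs_pos|]. rewrite <- Rmult_assoc. apply wbounded_neumann_term.
Qed.

Lemma neumann_follows_sign (sigma : I -> R) :
  (forall i, follows_sign (sigma i) (f i)) ->
  (forall i, Forall (fun e => follows_sign (sigma i) (fst e * sigma (snd e))) (T i)) ->
  forall i, follows_sign (sigma i) (neumann i).
Proof.
  intros Hf HT i. apply follows_sign_Series; [apply ex_series_neumann_term|].
  intros m. revert i. induction m as [|m IH]; intros i; [apply Hf|].
  now apply row_eval_follows_sign with sigma.
Qed.

End Neumann.

Lemma neumann_lipschitz W T T' lam f M eta :
  (forall i, 0 <= W i) -> 0 <= lam < 1 ->
  (forall i, row_norm W (T i) <= lam * W i) ->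
  (forall i, row_norm W (T' i) <= lam * W i) ->
  0 <= M -> wbounded W M f -> 0 <= eta ->
  wbounded W eta (fun i => row_eval (T i) (neumann T' f) - row_eval (T' i) (neumann T' f)) ->
  wbounded W (eta / (1 - lam)) (fun i => neumann T f i - neumann T' f i).
Proof.
  intros HW Hlam HT HT' HM Hf Heta Hdiff.
  assert (Hq : 0 <= M / (1 - lam)) by (apply Rdiv_le_0_compat; lra).
  apply (wbounded_fixed_point W T lam HW Hlam HT eta (2 * (M / (1 - lam)))
    (fun i => row_eval (T i) (neumann T' f) - row_eval (T' i) (neumann T' f)));
    [trivial|lra| |trivial|].
  - intros i. apply Rle_trans with (Rabs (neumann T f i) + Rabs (neumann T' f i)).
    + unfold Rminus. rewrite <- (Rabs_Ropp (neumann T' f i)). apply Rabs_triang.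
    + assert (H := wbounded_neumann W T lam Hlam HT f M HM Hf i).
      assert (H' := wbounded_neumann W T' lam Hlam HT' f M HM Hf i). lra.
  - intros i. rewrite row_eval_minus.
    rewrite (neumann_fixed_point W T lam Hlam HT f M HM Hf i) at 1.
    rewrite (neumann_fixed_point W T' lam Hlam HT' f M HM Hf i) at 1. ring.
Qed.

End RowFinite.

Arguments row I : clear implicits.

(** * Absolutely summable two-sided sequences *)

Definition Zsummable (x : Z -> R) : Prop :=
  ex_series (fun m => Rabs (x (Z.of_nat m))) /\
  ex_series (fun m => Rabs (x (- Z.of_nat m - 1)%Z)).

Definition Zsum (x : Z -> R) : R :=
  Series (fun m => x (Z.of_nat m)) + Series (fun m => x (- Z.of_nat m - 1)%Z).

Lemma Zsummable_le x y : (forall n, Rabs (x n) <= Rabs (y n)) -> Zsummable y -> Zsummable x.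
Proof.
  intros Hxy [Hr Hl].
  split; [apply (ex_series_le (V := R_CompleteNormedModule)) with (2 := Hr)
         |apply (ex_series_le (V := R_CompleteNormedModule)) with (2 := Hl)];
    intros m; change (norm ?z) with (Rabs z); rewrite Rabs_Rabsolu; apply Hxy.
Qed.

Lemma Zsummable_ext x y : (forall n, x n = y n) -> Zsummable x -> Zsummable y.
Proof. intros Hxy. apply Zsummable_le. intros n. rewrite Hxy. apply Rle_refl. Qed.

Lemma Zsummable_scal a x : Zsummable x -> Zsummable (fun n => a * x n).
Proof.
  assert (scal : forall u : nat -> R, ex_series (fun m => Rabs (u m)) ->
    ex_series (fun m => Rabs (a * u m))).
  { intros u Hu. apply ex_series_ext with (fun m => Rabs a * Rabs (u m)).
    - intros m. symmetry. apply Rabs_mult.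
    - now apply (ex_series_scal (K := R_AbsRing) (V := R_NormedModule) (Rabs a)). }
  intros [Hr Hl]. split; [exact (scal _ Hr)|exact (scal _ Hl)].
Qed.

Lemma Zsummable_bounded_mult G g x : (forall n, Rabs (g n) <= G) -> Zsummable x ->
  Zsummable (fun n => g n * x n).
Proof.
  intros Hg Hx. apply Zsummable_le with (fun n => G * x n); [|now apply Zsummable_scal].
  intros n. rewrite !Rabs_mult. apply Rmult_le_compat_r; [apply Rabs_pos|].
  apply Rle_trans with (1 := Hg n). apply Rle_abs.
Qed.

Lemma Zsummable_plus x y : Zsummable x -> Zsummable y -> Zsummable (fun n => x n + y n).
Proof.
  assert (plus : forall u v : nat -> R, ex_series (fun m => Rabs (u m)) ->
    ex_series (fun m => Rabs (v m)) -> ex_series (fun m => Rabs (u m + v m))).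
  { intros u v Hu Hv.
    apply (ex_series_le (V := R_CompleteNormedModule)) with (fun m => Rabs (u m) + Rabs (v m)).
    - intros m. change (norm ?z) with (Rabs z). rewrite Rabs_Rabsolu. apply Rabs_triang.
    - now apply (ex_series_plus (fun m => Rabs (u m))). }
  intros [Hr Hl] [Hr' Hl']. split; [exact (plus _ _ Hr Hr')|exact (plus _ _ Hl Hl')].
Qed.

Lemma Zsummable_shift i x : Zsummable x -> Zsummable (fun n => x (n + i)%Z).
Proof.
  assert (succ : forall y, Zsummable y -> Zsummable (fun n => y (n + 1)%Z)).
  { intros y [Hr Hl]. split.
    - apply ex_series_incr_1 in Hr. apply ex_series_ext with (2 := Hr).
      intros m. do 2 f_equal. lia.
    - apply ex_series_incr_1, ex_series_ext with (2 := Hl). intros m. do 2 f_equal. lia. }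
  assert (pred : forall y, Zsummable y -> Zsummable (fun n => y (n - 1)%Z)).
  { intros y [Hr Hl]. split.
    - apply ex_series_incr_1, ex_series_ext with (2 := Hr). intros m. do 2 f_equal. lia.
    - apply ex_series_incr_1 in Hl. apply ex_series_ext with (2 := Hl).
      intros m. do 2 f_equal. lia. }
  intros Hx. induction i as [|i IH|i IH] using Z.peano_ind.
  - apply Zsummable_ext with (2 := Hx). intros n. f_equal. lia.
  - apply Zsummable_ext with (2 := succ _ IH). intros n. f_equal. lia.
  - apply Zsummable_ext with (2 := pred _ IH). intros n. f_equal. lia.
Qed.

Lemma Zsum_ext x y : (forall n, x n = y n) -> Zsum x = Zsum y.
Proof. intros H. unfold Zsum. f_equal; apply Series_ext; intros; apply H. Qed.

Lemma Zsum_scal a x : Zsum (fun n => a * x n) = a * Zsum x.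
Proof. unfold Zsum. rewrite !Series_scal_l. ring. Qed.

Lemma Zsum_zero x : (forall n, x n = 0) -> Zsum x = 0.
Proof.
  intros Hx. rewrite (Zsum_ext x (fun n => 0 * x n)) by (intros n; rewrite Hx; ring).
  rewrite Zsum_scal. ring.
Qed.

Lemma Zsum_plus x y : Zsummable x -> Zsummable y ->
  Zsum (fun n => x n + y n) = Zsum x + Zsum y.
Proof.
  intros [Hr Hl] [Hr' Hl']. unfold Zsum.
  rewrite !Series_plus by now apply ex_series_Rabs. ring.
Qed.

Lemma Zsum_minus x y : Zsummable x -> Zsummable y ->
  Zsum (fun n => x n - y n) = Zsum x - Zsum y.
Proof.
  intros [Hr Hl] [Hr' Hl']. unfold Zsum.
  rewrite !Series_minus by now apply ex_series_Rabs. ring.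
Qed.

Lemma Zsum_shift i x : Zsummable x -> Zsum (fun n => x (n + i)%Z) = Zsum x.
Proof.
  assert (succ : forall y, Zsummable y -> Zsum (fun n => y (n + 1)%Z) = Zsum y).
  { intros y Hy. destruct (Zsummable_shift 1 y Hy) as [_ Hl'%ex_series_Rabs].
    destruct Hy as [Hr%ex_series_Rabs Hl%ex_series_Rabs]. unfold Zsum.
    rewrite (Series_incr_1 _ Hr), (Series_incr_1 _ Hl').
    rewrite (Series_ext (fun m => y (- Z.of_nat (S m) - 1 + 1)%Z)
      (fun m => y (- Z.of_nat m - 1)%Z)) by (intros m; f_equal; lia).
    rewrite (Series_ext (fun m => y (Z.of_nat m + 1)%Z) (fun m => y (Z.of_nat (S m))))
      by (intros m; f_equal; lia).
    simpl. ring. }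
  intros Hx. induction i as [|i IH|i IH] using Z.peano_ind; [|rewrite <- IH..].
  - apply Zsum_ext. intros n. f_equal. lia.
  - rewrite <- (succ (fun n => x (n + i)%Z)) by now apply Zsummable_shift.
    apply Zsum_ext. intros n. f_equal. lia.
  - rewrite <- (succ (fun n => x (n + Z.pred i)%Z)) by now apply Zsummable_shift.
    apply Zsum_ext. intros n. f_equal. lia.
Qed.

Lemma Zsum_eq_off_0 x y : (forall n, n <> 0%Z -> x n = y n) -> Zsummable y ->
  Zsum x = Zsum y + (x 0%Z - y 0%Z).
Proof.
  intros Hxy [Hr%ex_series_Rabs _]. unfold Zsum.
  assert (Hr' : ex_series (fun m => x (Z.of_nat m))).
  { apply ex_series_incr_1. apply ex_series_incr_1 in Hr. apply ex_series_ext with (2 := Hr).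
    intros m. symmetry. apply Hxy. lia. }
  rewrite (Series_incr_1 _ Hr), (Series_incr_1 _ Hr').
  rewrite (Series_ext (fun m => x (Z.of_nat (S m))) (fun m => y (Z.of_nat (S m))))
    by (intros m; apply Hxy; lia).
  rewrite (Series_ext (fun m => x (- Z.of_nat m - 1)%Z) (fun m => y (- Z.of_nat m - 1)%Z))
    by (intros m; apply Hxy; lia).
  change (Z.of_nat 0) with 0%Z. ring.
Qed.

Lemma Rabs_Zsum_le x y : Zsummable y -> (forall n, Rabs (x n) <= y n) -> Rabs (Zsum x) <= Zsum y.
Proof.
  intros Hy Hxy.
  assert (Hx : Zsummable x).
  { apply Zsummable_le with (2 := Hy). intros n.
    apply Rle_trans with (1 := Hxy n). apply Rle_abs. }
  destruct Hx as [Hr Hl]. destruct Hy as [Hr'%ex_series_Rabs Hl'%ex_series_Rabs].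
  apply Rle_trans with (1 := Rabs_triang _ _).
  apply Rplus_le_compat; [apply Rle_trans with (1 := Series_Rabs _ Hr)
                         |apply Rle_trans with (1 := Series_Rabs _ Hl)];
    apply Series_le; trivial; intros m; (split; [apply Rabs_pos|apply Hxy]).
Qed.

Lemma Zsum_pos x k : Zsummable x -> (forall n, 0 <= x n) -> 0 < x k -> 0 < Zsum x.
Proof.
  intros Hx Hpos Hk. rewrite <- (Zsum_shift k) by trivial.
  destruct (Zsummable_shift k x Hx) as [Hr%ex_series_Rabs Hl%ex_series_Rabs].
  unfold Zsum. rewrite (Series_incr_1 _ Hr). change (Z.of_nat 0 + k)%Z with k.
  assert (0 <= Series (fun m => x (Z.of_nat (S m) + k)%Z))
    by (apply Series_nonneg; [now apply ex_series_incr_1 in Hr|intros; apply Hpos]).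
  assert (0 <= Series (fun m => x (- Z.of_nat m - 1 + k)%Z))
    by (apply Series_nonneg; [trivial|intros; apply Hpos]).
  lra.
Qed.

(** * Two-step difference operators and their adjoints *)

Definition two_step (a b c : Z -> R) (x : Z -> R) (n : Z) : R :=
  a n * x n + b n * x (n + 1)%Z + c n * x (n + 2)%Z.

Definition two_step_adjoint (a b c : Z -> R) (y : Z -> R) (n : Z) : R :=
  a n * y n + b (n - 1)%Z * y (n - 1)%Z + c (n - 2)%Z * y (n - 2)%Z.

Lemma two_step_adjointness G a b c x y :
  (forall n, Rabs (a n) <= G) -> (forall n, Rabs (b n) <= G) -> (forall n, Rabs (c n) <= G) ->
  (exists X, forall n, Rabs (x n) <= X) -> Zsummable y ->
  Zsum (fun n => y n * two_step a b c x n) = Zsum (fun n => two_step_adjoint a b c y n * x n).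
Proof.
  intros Ha Hb Hc [X HX] Hy.
  assert (summable : forall g i, (forall n, Rabs (g n) <= G) ->
    Zsummable (fun n => g n * y n * x (n + i)%Z)).
  { intros g i Hg. apply Zsummable_ext with (fun n => x (n + i)%Z * (g n * y n));
      [intros n; ring|].
    apply Zsummable_bounded_mult with X; [intros n; apply HX|].
    now apply Zsummable_bounded_mult with G. }
  assert (shifted : forall g i, (forall n, Rabs (g n) <= G) ->
    Zsum (fun n => g n * y n * x (n + i)%Z)
    = Zsum (fun n => g (n - i)%Z * y (n - i)%Z * x n)).
  { intros g i Hg. rewrite <- (Zsum_shift (- i)) by now apply summable.
    apply Zsum_ext. intros n. now replace (n + - i + i)%Z with n by lia. }
  assert (summable' : forall g i, (forall n, Rabs (g n) <= G) ->
    Zsummable (fun n => g (n - i)%Z * y (n - i)%Z * x n)).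
  { intros g i Hg. apply Zsummable_ext with (2 := Zsummable_shift (- i) _ (summable g i Hg)).
    intros n. now replace (n + - i + i)%Z with n by lia. }
  transitivity (Zsum (fun n => a n * y n * x (n + 0)%Z) + Zsum (fun n => b n * y n * x (n + 1)%Z)
    + Zsum (fun n => c n * y n * x (n + 2)%Z)).
  - rewrite <- !Zsum_plus by auto using Zsummable_plus.
    apply Zsum_ext. intros n. unfold two_step. rewrite Z.add_0_r. ring.
  - rewrite !shifted, <- !Zsum_plus by auto using Zsummable_plus.
    apply Zsum_ext. intros n. unfold two_step_adjoint. rewrite Z.sub_0_r. ring.
Qed.

(** * Exponentially decaying sequences *)

Definition decays (rho M : R) (x : Z -> R) : Prop :=
  forall n, Rabs (x n) <= M * rho ^ Z.abs_nat n.

Section Decay.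

Variable rho : R.
Hypothesis rho_range : 0 < rho < 1.

Lemma pow_antitone a b : (a <= b)%nat -> rho ^ b <= rho ^ a.
Proof.
  intros Hab. replace b with (a + (b - a))%nat by lia. rewrite pow_add.
  rewrite <- (Rmult_1_r (rho ^ a)) at 2. apply Rmult_le_compat_l; [apply pow_le; lra|].
  rewrite <- (pow1 (b - a)). apply pow_incr. lra.
Qed.

Lemma pow_abs_near d n m : (Z.abs (n - m) <= Z.of_nat d)%Z ->
  rho ^ Z.abs_nat m <= / rho ^ d * rho ^ Z.abs_nat n.
Proof.
  intros H. apply Rmult_le_reg_l with (rho ^ d); [apply pow_lt; lra|].
  rewrite <- Rmult_assoc, Rinv_r, Rmult_1_l by (apply pow_nonzero; lra).
  rewrite <- pow_add. apply pow_antitone. lia.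
Qed.

Lemma Zsummable_pow_abs : Zsummable (fun n => rho ^ Z.abs_nat n).
Proof.
  assert (geom : ex_series (fun m => rho ^ m))
    by (eexists; apply is_series_geom; rewrite Rabs_pos_eq; lra).
  split; apply (ex_series_le (V := R_CompleteNormedModule)) with (2 := geom);
    intros m; change (norm ?z) with (Rabs z);
    rewrite Rabs_Rabsolu, Rabs_pos_eq by (apply pow_le; lra); apply pow_antitone; lia.
Qed.

Lemma decays_Zsummable M x : decays rho M x -> Zsummable x.
Proof.
  intros Hx. apply Zsummable_le with (fun n => M * rho ^ Z.abs_nat n).
  - intros n. apply Rle_trans with (1 := Hx n). apply Rle_abs.
  - apply Zsummable_scal, Zsummable_pow_abs.
Qed.

Lemma decays_nonneg M x : decays rho M x -> 0 <= M.
Proof.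
  intros Hx. assert (H := Hx 0%Z). simpl in H. assert (H' := Rabs_pos (x 0%Z)). lra.
Qed.

Lemma decays_Rabs_le M x : decays rho M x -> forall n, Rabs (x n) <= M.
Proof.
  intros Hx n. apply Rle_trans with (1 := Hx n). rewrite <- (Rmult_1_r M) at 2.
  apply Rmult_le_compat_l; [exact (decays_nonneg M x Hx)|]. apply (pow_antitone 0). lia.
Qed.

Lemma decays_Zsummable_pow2 M x : decays rho M x -> Zsummable (fun n => x n ^ 2).
Proof.
  intros Hx. apply Zsummable_ext with (fun n => x n * x n); [intros n; ring|].
  apply Zsummable_bounded_mult with M; [now apply decays_Rabs_le|].
  now apply decays_Zsummable with M.
Qed.

Lemma decays_Rabs_Zsum_le M x : decays rho M x ->
  Rabs (Zsum x) <= M * Zsum (fun n => rho ^ Z.abs_nat n).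
Proof.
  intros Hx. rewrite <- Zsum_scal.
  apply Rabs_Zsum_le; [apply Zsummable_scal, Zsummable_pow_abs|exact Hx].
Qed.

End Decay.

(** * Singular perturbed 2x2 matrices *)

Lemma perturbed_quadratic_root N e C t D :
  0 < N -> 0 < e -> 0 <= C -> 0 < t -> (C + 1) / (N * e) * t < e ->
  (forall E, 0 <= E <= 2 * e * t -> Rabs (D E - N * (E ^ 2 - (e * t) ^ 2)) <= C * t ^ 3) ->
  (forall E, 0 <= E <= 2 * e * t -> continuity_pt D E) ->
  exists E, 0 <= E <= 2 * e * t /\ Rabs (E - e * t) <= (C + 1) / (N * e) * t ^ 2 /\ D E = 0.
Proof.
  intros HN He HC Ht Hsmall HD Hcont.
  set (L := (C + 1) / (N * e)) in *.
  assert (HL : 0 < L) by (apply Rdiv_lt_0_compat; [lra|now apply Rmult_lt_0_compat]).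
  assert (HNeL : N * e * L = C + 1) by (unfold L; field; lra).
  assert (HNL : 0 < N * L) by now apply Rmult_lt_0_compat.
  assert (Ht3 : 0 < t ^ 3) by now apply pow_lt.
  assert (Hrad : 0 < L * t ^ 2 < e * t) by (simpl; split; nra).
  destruct (IVT_interv D (e * t - L * t ^ 2) (e * t + L * t ^ 2)) as [E [HE HDE]].
  - intros E HE. apply Hcont. lra.
  - lra.
  - assert (H := HD (e * t - L * t ^ 2) ltac:(lra)). apply Rabs_le_between in H.
    replace (N * ((e * t - L * t ^ 2) ^ 2 - (e * t) ^ 2)) with
      (- (2 * (N * e * L) - N * L * (L * t)) * t ^ 3) in H by ring.
    assert (N * L * (L * t) <= N * L * e) by (apply Rmult_le_compat_l; lra).
    assert (C * t ^ 3 < (2 * (N * e * L) - N * L * (L * t)) * t ^ 3)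
      by (apply Rmult_lt_compat_r; lra).
    lra.
  - assert (H := HD (e * t + L * t ^ 2) ltac:(lra)). apply Rabs_le_between in H.
    replace (N * ((e * t + L * t ^ 2) ^ 2 - (e * t) ^ 2)) with
      ((2 * (N * e * L) + N * L * (L * t)) * t ^ 3) in H by ring.
    assert (0 <= N * L * (L * t)) by (apply Rlt_le, Rmult_lt_0_compat; nra).
    assert (C * t ^ 3 < (2 * (N * e * L) + N * L * (L * t)) * t ^ 3)
      by (apply Rmult_lt_compat_r; lra).
    lra.
  - exists E. split; [lra|]. split; [apply Rabs_le; lra|exact HDE].
Qed.

Lemma product_error x y u v X A A' C : Rabs x <= A * X -> Rabs y <= A' * X ->
  0 <= C -> 0 <= X <= 1 -> Rabs (u - x) <= C * X ^ 2 -> Rabs (v - y) <= C * X ^ 2 ->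
  Rabs (u * v - x * y) <= C * (A + A' + C) * X ^ 3.
Proof.
  intros Hx Hy HC HX Hu Hv.
  replace (u * v - x * y) with (x * (v - y) + (u - x) * y + (u - x) * (v - y)) by ring.
  apply Rle_trans with (A * X * (C * X ^ 2) + C * X ^ 2 * (A' * X) + C * X ^ 2 * (C * X ^ 2)).
  - eapply Rle_trans; [apply Rabs_triang|].
    apply Rplus_le_compat; [eapply Rle_trans; [apply Rabs_triang|]; apply Rplus_le_compat|];
      rewrite Rabs_mult; apply Rmult_le_compat; trivial; apply Rabs_pos.
  - assert (0 <= C * C * X ^ 3 * (1 - X)).
    { apply Rmult_le_pos; [|lra]. apply Rmult_le_pos; [nra|apply pow_le; lra]. }
    replace (C * (A + A' + C) * X ^ 3) with
      (A * X * (C * X ^ 2) + C * X ^ 2 * (A' * X) + C * C * X ^ 3) by ring.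
    replace (C * X ^ 2 * (C * X ^ 2)) with (C * C * X ^ 3 - C * C * X ^ 3 * (1 - X)) by ring.
    lra.
Qed.

Lemma perturbed_det_error N1 N2 k1 k2 C E s a11 a12 a21 a22 :
  0 <= N1 -> 0 <= N2 -> 0 <= k1 -> 0 <= k2 -> 0 <= C -> Rabs E + Rabs s <= 1 ->
  Rabs (a11 - E * N1) <= C * (Rabs E + Rabs s) ^ 2 ->
  Rabs (a12 - s * k1) <= C * (Rabs E + Rabs s) ^ 2 ->
  Rabs (a21 - s * k2) <= C * (Rabs E + Rabs s) ^ 2 ->
  Rabs (a22 - E * N2) <= C * (Rabs E + Rabs s) ^ 2 ->
  Rabs (a11 * a22 - a12 * a21 - (N1 * N2 * E ^ 2 - k1 * k2 * s ^ 2))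
    <= C * (N1 + N2 + k1 + k2 + 2 * C) * (Rabs E + Rabs s) ^ 3.
Proof.
  intros HN1 HN2 Hk1 Hk2 HC HX H11 H12 H21 H22.
  assert (HE := Rabs_pos E). assert (Hs := Rabs_pos s).
  set (X := Rabs E + Rabs s) in *.
  assert (leading : forall u k, 0 <= k -> Rabs u <= X -> Rabs (u * k) <= k * X).
  { intros u k Hk Hu. rewrite Rabs_mult, (Rabs_pos_eq k), Rmult_comm by trivial.
    now apply Rmult_le_compat_l. }
  assert (P1 : Rabs (a11 * a22 - E * N1 * (E * N2)) <= C * (N1 + N2 + C) * X ^ 3)
    by (apply product_error; trivial; try apply leading; unfold X in *; trivial; lra).
  assert (P2 : Rabs (a12 * a21 - s * k1 * (s * k2)) <= C * (k1 + k2 + C) * X ^ 3)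
    by (apply product_error; trivial; try apply leading; unfold X in *; trivial; lra).
  replace (a11 * a22 - a12 * a21 - (N1 * N2 * E ^ 2 - k1 * k2 * s ^ 2)) with
    (a11 * a22 - E * N1 * (E * N2) - (a12 * a21 - s * k1 * (s * k2))) by ring.
  unfold Rminus at 1. eapply Rle_trans; [apply Rabs_triang|]. rewrite Rabs_Ropp. lra.
Qed.

Lemma perturbed_det_root (N1 N2 k1 k2 C r0 : R) :
  0 < N1 -> 0 < N2 -> 0 < k1 -> 0 < k2 -> 0 <= C -> 0 < r0 ->
  exists e s0 L : R, 0 < e /\ 0 < s0 /\ 0 < L /\
  forall (s : R) (a11 a12 a21 a22 : R -> R), 0 < Rabs s < s0 ->
    (forall E, Rabs E < r0 ->
       Rabs (a11 E - E * N1) <= C * (Rabs E + Rabs s) ^ 2 /\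
       Rabs (a12 E - s * k1) <= C * (Rabs E + Rabs s) ^ 2 /\
       Rabs (a21 E - s * k2) <= C * (Rabs E + Rabs s) ^ 2 /\
       Rabs (a22 E - E * N2) <= C * (Rabs E + Rabs s) ^ 2) ->
    (forall E, Rabs E < r0 ->
       continuity_pt (fun E => a11 E * a22 E - a12 E * a21 E) E) ->
    exists E, Rabs E < r0 /\ Rabs (E - e * Rabs s) <= L * s ^ 2 /\
      a11 E * a22 E - a12 E * a21 E = 0.
Proof.
  intros HN1 HN2 Hk1 Hk2 HC Hr0.
  set (N := N1 * N2). assert (HN : 0 < N) by now apply Rmult_lt_0_compat.
  set (e := sqrt (k1 * k2 / N)).
  assert (Hkn : 0 < k1 * k2 / N) by (apply Rdiv_lt_0_compat; [now apply Rmult_lt_0_compat|trivial]).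
  assert (He : 0 < e) by now apply sqrt_lt_R0.
  assert (Hee : N * e ^ 2 = k1 * k2) by (unfold e; rewrite pow2_sqrt by lra; field; lra).
  set (C' := C * (N1 + N2 + k1 + k2 + 2 * C) * (2 * e + 1) ^ 3).
  assert (HC' : 0 <= C')
    by (apply Rmult_le_pos; [apply Rmult_le_pos; lra|apply pow_le; lra]).
  set (L := (C' + 1) / (N * e)).
  assert (HL : 0 < L) by (apply Rdiv_lt_0_compat; [lra|now apply Rmult_lt_0_compat]).
  exists e, (Rmin (e / L) (Rmin 1 r0 / (2 * e + 1))), L.
  assert (Hmin : 0 < Rmin 1 r0) by (apply Rmin_glb_lt; lra).
  repeat split; trivial; [apply Rmin_glb_lt; apply Rdiv_lt_0_compat; lra|].
  intros s a11 a12 a21 a22 [Hs Hs0] Ha Hcont.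
  assert (HsL : L * Rabs s < e).
  { assert (H := Rlt_le_trans _ _ _ Hs0 (Rmin_l _ _)).
    apply Rlt_div_r in H; [lra|trivial]. }
  assert (Hsr : (2 * e + 1) * Rabs s < Rmin 1 r0).
  { assert (H := Rlt_le_trans _ _ _ Hs0 (Rmin_r _ _)). apply Rlt_div_r in H; lra. }
  assert (Hs1 := Rlt_le_trans _ _ _ Hsr (Rmin_l _ _)).
  assert (Hs2 := Rlt_le_trans _ _ _ Hsr (Rmin_r _ _)).
  destruct (perturbed_quadratic_root N e C' (Rabs s) (fun E => a11 E * a22 E - a12 E * a21 E))
    as [E [HE [HEs HE0]]]; trivial.
  - intros E HE. assert (HEabs : Rabs E = E) by (apply Rabs_pos_eq; lra).
    destruct (Ha E) as [H11 [H12 [H21 H22]]]; [lra|].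
    replace (N * (E ^ 2 - (e * Rabs s) ^ 2)) with (N1 * N2 * E ^ 2 - k1 * k2 * s ^ 2)
      by (rewrite <- Hee, <- (pow2_abs s); unfold N; ring).
    eapply Rle_trans; [apply perturbed_det_error with (C := C); trivial; lra|].
    replace (C' * Rabs s ^ 3) with
      (C * (N1 + N2 + k1 + k2 + 2 * C) * ((2 * e + 1) * Rabs s) ^ 3) by (unfold C'; ring).
    apply Rmult_le_compat_l; [apply Rmult_le_pos; lra|]. apply pow_incr. lra.
  - intros E HE. apply Hcont. rewrite Rabs_pos_eq; lra.
  - exists E. rewrite Rabs_pos_eq, <- (pow2_abs s) by lra. repeat split; trivial. lra.
Qed.

Lemma singular_2x2_kernel a11 a12 a21 a22 : a11 * a22 - a12 * a21 = 0 ->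
  exists t1 t2, (t1 <> 0 \/ t2 <> 0) /\
    t1 * a11 + t2 * a12 = 0 /\ t1 * a21 + t2 * a22 = 0.
Proof.
  intros Hdet. destruct (Req_dec a11 0) as [H11|H11]; [destruct (Req_dec a12 0) as [H12|H12]|].
  - destruct (Req_dec a21 0) as [H21|H21].
    + exists 1, 0. repeat split; [left|..]; lra.
    + exists (- a22), a21. repeat split; [now right|..]; nra.
  - exists a12, (- a11). repeat split; [now left|..]; lra.
  - exists (- a12), a11. repeat split; [now right|..]; lra.
Qed.

(** * The real interface system *)

(* [Re1], [Im1], ... are the real and imaginary parts of [w_1], ... after the gauge change.
   [Diff1 n = Re1 n - zeta * Re1 (n - 1)] and [Diff4 n = Re4 (n + 1) - omega * Re4 n] factor the
   second-order recursions to the right of the interface. *)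
Inductive component := Re1 | Im1 | Re2 | Re4 | Im4 | Re5 | Diff1 | Diff4.

Definition index : Type := component * Z.

Definition state : Type := index -> R.

Ltac split_on_sites :=
  repeat match goal with
  | |- context [Z.leb ?a ?b] => destruct (Z.leb_spec a b); try lia
  | |- context [Z.eqb ?a ?b] => destruct (Z.eqb_spec a b); try lia
  end.

Section RealSystem.

Variables bp bm dp dm c zeta omega : R.

Local Notation bn := (coef_b bp bm).
Local Notation cn := (coef_c bp bm dp dm c).
Local Notation dn := (coef_d bp bm dp dm c).

Definition coef_m (n : Z) : R := 2 * bn n * bn (n + 2) / dn n.

Local Notation mn := coef_m.

Definition real_system (E C s : R) (x : state) : Prop := forall n,
  E * x (Re1, n) = bn n * x (Re4, n) + bn n * x (Re5, n)
    + cn n * (C * x (Re4, n + 1)%Z - s * x (Im4, n + 1)%Z) /\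
  E * x (Im1, n) = bn n * x (Im4, n) - cn n * (C * x (Im4, n + 1)%Z + s * x (Re4, n + 1)%Z) /\
  E * x (Re2, n) = 2 * bn n * x (Re4, n) + dn (n - 2) * x (Re5, n - 2)%Z /\
  E * x (Re4, n) = bn n * x (Re1, n) + bn n * x (Re2, n)
    + cn (n - 1) * (C * x (Re1, n - 1)%Z - s * x (Im1, n - 1)%Z) /\
  E * x (Im4, n) = bn n * x (Im1, n)
    - cn (n - 1) * (C * x (Im1, n - 1)%Z + s * x (Re1, n - 1)%Z) /\
  E * x (Re5, n) = 2 * bn n * x (Re1, n) + dn n * x (Re2, n + 2)%Z.

(* Once [Re2] and [Re5] are eliminated from the equations of the other components, the system
   reads [balance j x n = row_eval (source E s v j n) x] with [s = sin (k / 2)] and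
   [v = 1 - cos (k / 2)]; the operators for [Im4], [Im1] and for [Re4], [Re1] are mutually
   adjoint. *)
Definition balance (j : component) (x : state) : Z -> R :=
  match j with
  | Im4 => two_step bn (fun n => - cn n) (fun _ => 0) (fun n => x (Im4, n))
  | Im1 => two_step_adjoint bn (fun n => - cn n) (fun _ => 0) (fun n => x (Im1, n))
  | Re4 => two_step bn cn (fun n => - mn n) (fun n => x (Re4, n))
  | Re1 => two_step_adjoint bn cn (fun n => - mn n) (fun n => x (Re1, n))
  | Re2 => fun n => dn n * x (Re2, n + 2)%Z + 2 * bn n * x (Re1, n)
  | Re5 => fun n => dn n * x (Re5, n) + 2 * bn (n + 2) * x (Re4, n + 2)%Z
  | Diff1 | Diff4 => fun _ => 0
  end.

Definition source (E s v : R) (j : component) (n : Z) : row index :=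
  match j with
  | Im4 => [(E, (Im1, n)); (s * cn n, (Re4, n + 1)%Z); (- v * cn n, (Im4, n + 1)%Z)]
  | Im1 => [(E, (Im4, n)); (s * cn (n - 1), (Re1, n - 1)%Z);
            (- v * cn (n - 1), (Im1, n - 1)%Z)]
  | Re1 => [(E, (Re4, n)); (s * cn (n - 1), (Im1, n - 1)%Z); (v * cn (n - 1), (Re1, n - 1)%Z);
            (- E * (bn n / dn (n - 2)), (Re5, n - 2)%Z)]
  | Re4 => [(E, (Re1, n)); (s * cn n, (Im4, n + 1)%Z); (v * cn n, (Re4, n + 1)%Z);
            (- E * (bn n / dn n), (Re2, n + 2)%Z)]
  | Re2 => [(E, (Re5, n))]
  | Re5 => [(E, (Re2, n + 2)%Z)]
  | Diff1 | Diff4 => []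
  end.

(* Each equation is solved for the entry that makes it contracting; those for [Im1] and [Re4]
   at [n = 0] are the only ones left out. *)
Definition propagation (i : index) : row index :=
  let (j, n) := i in
  match j with
  | Im4 => if Z.leb 1 n then [(bn (n - 1) / cn (n - 1), (Im4, n - 1)%Z)]
           else if Z.eqb n 0 then [] else [(cn n / bn n, (Im4, n + 1)%Z)]
  | Im1 => if Z.leb 0 n then [(bn (n + 1) / cn n, (Im1, n + 1)%Z)]
           else [(cn (n - 1) / bn n, (Im1, n - 1)%Z)]
  | Re1 => if Z.leb 1 n then [(zeta, (Re1, n - 1)%Z); (1, (Diff1, n))]
           else if Z.eqb n 0 then []
           else [(bn (n + 2) / mn n, (Re1, n + 2)%Z); (cn (n + 1) / mn n, (Re1, n + 1)%Z)]
  | Diff1 => if Z.leb 1 n then [(omega, (Diff1, n + 1)%Z)] else []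
  | Re4 => if Z.leb 2 n then [(omega, (Re4, n - 1)%Z); (1, (Diff4, n - 1)%Z)]
           else [(bn (n - 2) / mn (n - 2), (Re4, n - 2)%Z);
                 (cn (n - 2) / mn (n - 2), (Re4, n - 1)%Z)]
  | Diff4 => if Z.leb 1 n then [(zeta, (Diff4, n + 1)%Z)] else []
  | Re2 => [(- (2 * bn (n - 2) / dn (n - 2)), (Re1, n - 2)%Z)]
  | Re5 => [(- (2 * bn (n + 2) / dn n), (Re4, n + 2)%Z)]
  end.

Definition forcing (E s v : R) (i : index) : row index :=
  let (j, n) := i in
  match j with
  | Im4 => if Z.leb 1 n then row_scale (- / cn (n - 1)) (source E s v Im4 (n - 1))
           else if Z.eqb n 0 then [] else row_scale (/ bn n) (source E s v Im4 n)
  | Im1 => if Z.leb 0 n then row_scale (- / cn n) (source E s v Im1 (n + 1))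
           else row_scale (/ bn n) (source E s v Im1 n)
  | Re1 => if Z.leb 0 n then [] else row_scale (- / mn n) (source E s v Re1 (n + 2))
  | Diff1 => if Z.leb 1 n then row_scale (- omega / bp) (source E s v Re1 (n + 1)) else []
  | Re4 => if Z.leb 2 n then [] else row_scale (- / mn (n - 2)) (source E s v Re4 (n - 2))
  | Diff4 => if Z.leb 1 n then row_scale (zeta / mn n) (source E s v Re4 n) else []
  | Re2 => row_scale (/ dn (n - 2)) (source E s v Re2 (n - 2))
  | Re5 => row_scale (/ dn n) (source E s v Re5 n)
  end.

Definition sweep (E s v : R) (i : index) : row index := propagation i ++ forcing E s v i.

Definition seed (t1 t2 : R) : state := fun i =>
  match i with
  | (Im4, n) => if Z.eqb n 0 then t1 else 0
  | (Re1, n) => if Z.eqb n 0 then t2 else 0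
  | _ => 0
  end.

Definition sweep_fixed_point (E s v t1 t2 : R) (x : state) : Prop :=
  forall i, x i = seed t1 t2 i + row_eval (sweep E s v i) x.

Lemma coef_b_right n : (0 <= n)%Z -> bn n = bp.
Proof. intros H. unfold coef_b. now rewrite (proj2 (Z.leb_le 0 n) H). Qed.

Lemma coef_b_left n : (n <= -1)%Z -> bn n = bm.
Proof. intros H. unfold coef_b. destruct (Z.leb_spec 0 n); [lia|reflexivity]. Qed.

Lemma coef_c_right n : (0 <= n)%Z -> cn n = bp + dp.
Proof. intros H. unfold coef_c. now rewrite (proj2 (Z.leb_le 0 n) H). Qed.

Lemma coef_c_left n : (n <= -2)%Z -> cn n = bm + dm.
Proof.
  intros H. unfold coef_c. destruct (Z.leb_spec 0 n); [lia|].
  destruct (Z.eqb_spec n (-1)); [lia|reflexivity].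
Qed.

Lemma coef_d_right n : (0 <= n)%Z -> dn n = bp + dp.
Proof. intros H. unfold coef_d. now rewrite (proj2 (Z.leb_le 0 n) H). Qed.

Lemma coef_d_left n : (n <= -3)%Z -> dn n = bm + dm.
Proof.
  intros H. unfold coef_d. destruct (Z.leb_spec 0 n); [lia|].
  destruct (Z.leb_spec (-2) n); [lia|reflexivity].
Qed.

Lemma coef_m_right n : (0 <= n)%Z -> mn n = 2 * bp * bp / (bp + dp).
Proof. intros H. unfold coef_m. now rewrite !coef_b_right, coef_d_right by lia. Qed.

Hypotheses (bp_pos : 0 < bp) (bm_pos : 0 < bm) (cp_pos : 0 < bp + dp) (cm_pos : 0 < bm + dm)
  (c_pos : 0 < c).

Lemma coef_b_pos n : 0 < bn n.
Proof. unfold coef_b. now destruct (Z.leb 0 n). Qed.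

Lemma coef_c_pos n : 0 < cn n.
Proof. unfold coef_c. now destruct (Z.leb 0 n), (Z.eqb n (-1)). Qed.

Lemma coef_d_pos n : 0 < dn n.
Proof. unfold coef_d. now destruct (Z.leb 0 n), (Z.leb (-2) n). Qed.

Lemma coef_m_pos n : 0 < mn n.
Proof.
  apply Rdiv_lt_0_compat; [|apply coef_d_pos].
  assert (H := coef_b_pos n). apply Rmult_lt_0_compat; [lra|apply coef_b_pos].
Qed.

(* [zeta] and [/ omega] are the roots of [bp X^2 + (bp + dp) X - m], where [m] is the value of
   [coef_m] on the right. *)
Hypotheses (zeta_range : 0 < zeta < 1) (omega_range : -1 < omega < 0)
  (root_sum : (bp + dp) * omega = - bp * (1 + zeta * omega))
  (root_product : 2 * bp * bp / (bp + dp) * omega = - bp * zeta).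

Section FixedPoint.

Variables (E s v t1 t2 : R) (x : state).
Hypothesis x_fixed : sweep_fixed_point E s v t1 t2 x.

Local Notation src j n := (row_eval (source E s v j n) x).

Ltac expand_at i :=
  rewrite (x_fixed i); unfold seed, sweep, propagation, forcing; split_on_sites;
  rewrite row_eval_app, ?row_eval_scale; cbn [row_eval fold_right fst snd].

Lemma fixed_point_Im4_0 : x (Im4, 0%Z) = t1.
Proof. rewrite x_fixed. simpl. ring. Qed.

Lemma fixed_point_Re1_0 : x (Re1, 0%Z) = t2.
Proof. rewrite x_fixed. simpl. ring. Qed.

Lemma balance_Im4 n : balance Im4 x n = src Im4 n.
Proof.
  assert (Hb := coef_b_pos n). assert (Hc := coef_c_pos n).
  unfold balance, two_step. destruct (Z_lt_le_dec n 0).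
  - expand_at (Im4, n). field. lra.
  - expand_at (Im4, n + 1)%Z. replace (n + 1 - 1)%Z with n by lia. field. lra.
Qed.

Lemma balance_Im1 n : n <> 0%Z -> balance Im1 x n = src Im1 n.
Proof.
  intros Hn. assert (Hb := coef_b_pos n). assert (Hc := coef_c_pos (n - 1)).
  unfold balance, two_step_adjoint. destruct (Z_lt_le_dec n 0).
  - expand_at (Im1, n). field. lra.
  - expand_at (Im1, n - 1)%Z. replace (n - 1 + 1)%Z with n by lia. field. lra.
Qed.

Lemma balance_Re1_right n : (2 <= n)%Z -> balance Re1 x n = src Re1 n.
Proof.
  intros Hn. unfold balance, two_step_adjoint.
  expand_at (Re1, n). expand_at (Re1, n - 1)%Z. expand_at (Diff1, n - 1)%Z.
  replace (n - 1 + 1)%Z with n by lia. replace (n - 1 - 1)%Z with (n - 2)%Z by lia.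
  rewrite coef_b_right, coef_c_right, coef_m_right by lia.
  set (m := 2 * bp * bp / (bp + dp)) in *.
  set (f := src Re1 n). set (g := x (Diff1, n)).
  assert (Hm : m = (bp * zeta + (bp + dp)) * zeta).
  { apply Rmult_eq_reg_r with omega; [|lra].
    replace ((bp * zeta + (bp + dp)) * zeta * omega) with
      ((bp * zeta * omega + (bp + dp) * omega) * zeta) by ring.
    rewrite root_sum, root_product. ring. }
  assert (Hsum : (bp * zeta + (bp + dp)) * omega = - bp) by lra.
  rewrite Hm.
  transitivity (bp * g + (bp * zeta + (bp + dp)) * omega * (g - f / bp)); [field; lra|].
  rewrite Hsum. field. lra.
Qed.

Lemma balance_Re1 n : balance Re1 x n = src Re1 n.
Proof.
  destruct (Z_lt_le_dec n 2); [|now apply balance_Re1_right].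
  unfold balance, two_step_adjoint. assert (Hm := coef_m_pos (n - 2)).
  expand_at (Re1, n - 2)%Z.
  replace (n - 2 + 2)%Z with n by lia. replace (n - 2 + 1)%Z with (n - 1)%Z by lia.
  field. lra.
Qed.

Lemma balance_Re4_right n : (1 <= n)%Z -> balance Re4 x n = src Re4 n.
Proof.
  intros Hn. unfold balance, two_step.
  expand_at (Re4, n + 2)%Z. replace (n + 2 - 1)%Z with (n + 1)%Z by lia.
  expand_at (Re4, n + 1)%Z. replace (n + 1 - 1)%Z with n by lia.
  expand_at (Diff4, n).
  assert (Hm := coef_m_pos n). rewrite coef_m_right in * by lia.
  rewrite coef_b_right, coef_c_right by lia.
  set (m := 2 * bp * bp / (bp + dp)) in *.
  set (f := src Re4 n). set (h := x (Diff4, (n + 1)%Z)).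
  assert (Hroot : bp + (bp + dp) * omega - m * omega * omega = 0)
    by (rewrite root_sum, root_product; ring).
  assert (Hm' : ((bp + dp) - m * omega) * zeta = m).
  { apply Rmult_eq_reg_r with omega; [|lra].
    replace (((bp + dp) - m * omega) * zeta * omega) with
      (((bp + dp) * omega - m * omega * omega) * zeta) by ring.
    rewrite root_sum, root_product. ring. }
  transitivity ((bp + (bp + dp) * omega - m * omega * omega) * x (Re4, n)
    + ((bp + dp) - m * omega) * zeta * (h + f / m) - m * h); [field; lra|].
  rewrite Hroot, Hm'. field. lra.
Qed.

Lemma balance_Re4 n : n <> 0%Z -> balance Re4 x n = src Re4 n.
Proof.
  intros Hn. destruct (Z_lt_le_dec n 1); [|now apply balance_Re4_right].
  unfold balance, two_step. assert (Hm := coef_m_pos n).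
  expand_at (Re4, n + 2)%Z.
  replace (n + 2 - 2)%Z with n by lia. replace (n + 2 - 1)%Z with (n + 1)%Z by lia.
  field. lra.
Qed.

Lemma balance_Re2 n : balance Re2 x n = src Re2 n.
Proof.
  unfold balance. assert (Hd := coef_d_pos n). expand_at (Re2, n + 2)%Z.
  replace (n + 2 - 2)%Z with n by lia. field. lra.
Qed.

Lemma balance_Re5 n : balance Re5 x n = src Re5 n.
Proof. unfold balance. assert (Hd := coef_d_pos n). expand_at (Re5, n). field. lra. Qed.

End FixedPoint.

Definition decaying_solution (rho E C s : R) (x : state) : Prop :=
  (exists M, forall j, decays rho M (fun n => x (j, n))) /\ real_system E C s x /\
  (x (Im4, 0%Z) <> 0 \/ x (Re1, 0%Z) <> 0).

Lemma balanced_real_system E s v x :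
  (forall j n, balance j x n = row_eval (source E s v j n) x) -> real_system E (1 - v) s x.
Proof.
  intros Hx n.
  assert (eq_Im4 := Hx Im4 n). assert (eq_Im1 := Hx Im1 n).
  assert (eq_Re4 := Hx Re4 n). assert (eq_Re1 := Hx Re1 n).
  assert (eq_Re2 := Hx Re2 n). assert (eq_Re5 := Hx Re5 n).
  assert (eq_Re2_shifted := Hx Re2 (n - 2)%Z). assert (eq_Re5_shifted := Hx Re5 (n - 2)%Z).
  unfold balance, two_step, two_step_adjoint, source in *.
  cbn [row_eval fold_right fst snd] in *.
  replace (n - 2 + 2)%Z with n in * by lia.
  assert (Hd := coef_d_pos n). assert (Hd2 := coef_d_pos (n - 2)).
  assert (Re5_elim : bn n * x (Re5, n)
    = - mn n * x (Re4, n + 2)%Z + E * (bn n / dn n) * x (Re2, n + 2)%Z).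
  { transitivity (bn n / dn n * (dn n * x (Re5, n))); [field; lra|].
    replace (dn n * x (Re5, n)) with (E * x (Re2, n + 2)%Z - 2 * bn (n + 2) * x (Re4, n + 2)%Z)
      by lra.
    unfold coef_m. field. lra. }
  assert (Re2_elim : bn n * x (Re2, n)
    = - mn (n - 2) * x (Re1, n - 2)%Z + E * (bn n / dn (n - 2)) * x (Re5, n - 2)%Z).
  { transitivity (bn n / dn (n - 2) * (dn (n - 2) * x (Re2, n))); [field; lra|].
    replace (dn (n - 2) * x (Re2, n)) with
      (E * x (Re5, n - 2)%Z - 2 * bn (n - 2) * x (Re1, n - 2)%Z) by lra.
    unfold coef_m. replace (n - 2 + 2)%Z with n by lia. field. lra. }
  repeat split; lra.
Qed.

Definition defect (E s v : R) (j : component) (x : state) : R :=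
  balance j x 0 - row_eval (source E s v j 0) x.

Lemma fixed_point_real_system E s v t1 t2 x : sweep_fixed_point E s v t1 t2 x ->
  defect E s v Im1 x = 0 -> defect E s v Re4 x = 0 -> real_system E (1 - v) s x.
Proof.
  intros Hx Hdef1 Hdef4. apply balanced_real_system. intros j n.
  destruct j.
  - now apply balance_Re1 with t1 t2.
  - destruct (Z.eq_dec n 0) as [-> | Hn]; [now apply Rminus_diag_uniq|].
    now apply balance_Im1 with t1 t2.
  - now apply balance_Re2 with t1 t2.
  - destruct (Z.eq_dec n 0) as [-> | Hn]; [now apply Rminus_diag_uniq|].
    now apply balance_Re4 with t1 t2.
  - now apply balance_Im4 with t1 t2.
  - now apply balance_Re5 with t1 t2.
  - reflexivity.
  - reflexivity.
Qed.

Lemma sweep_fixed_point_combination E s v t1 t2 x y :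
  sweep_fixed_point E s v 1 0 x -> sweep_fixed_point E s v 0 1 y ->
  sweep_fixed_point E s v t1 t2 (fun i => t1 * x i + t2 * y i).
Proof.
  intros Hx Hy i. rewrite row_eval_linear, (Hx i), (Hy i).
  destruct i as [[] n]; unfold seed; try destruct (Z.eqb n 0); ring.
Qed.

Lemma defect_linear E s v j t1 t2 x y :
  defect E s v j (fun i => t1 * x i + t2 * y i)
  = t1 * defect E s v j x + t2 * defect E s v j y.
Proof.
  unfold defect. rewrite row_eval_linear.
  destruct j; unfold balance, two_step, two_step_adjoint; ring.
Qed.

Lemma source_minus E s v E' s' v' j n x :
  row_eval (source E s v j n) x - row_eval (source E' s' v' j n) x
  = row_eval (source (E - E') (s - s') (v - v') j n) x.
Proof. destruct j; cbn [source row_eval fold_right fst snd]; ring. Qed.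

Lemma sweep_minus E s v E' s' v' i x :
  row_eval (sweep E s v i) x - row_eval (sweep E' s' v' i) x
  = row_eval (forcing (E - E') (s - s') (v - v') i) x.
Proof.
  unfold sweep. rewrite !row_eval_app. destruct i as [[] n]; unfold forcing; split_on_sites;
    rewrite ?row_eval_scale, <- ?source_minus; cbn [row_eval fold_right]; ring.
Qed.

(** * Contraction in weighted sup norms *)

Section Weights.

Variables rho B : R.
Hypotheses (rho_range : 0 < rho < 1) (B_ge_2 : 2 <= B)
  (right_rate : bp / (bp + dp) <= rho ^ 4) (left_rate : (bm + dm) / bm <= rho ^ 4)
  (zeta_rate : zeta <= rho ^ 4) (omega_rate : - omega <= rho ^ 4)
  (coef_b_bounds : forall n, / B <= bn n <= B)
  (coef_c_bounds : forall n, / B <= cn n <= B)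
  (coef_d_bounds : forall n, / B <= dn n <= B).

(* The weight grows by a large factor with the level, so that only the entries of [propagation]
   on the same level need a small coefficient; those across the interface go to a lower one. *)
Definition level (i : index) : nat :=
  let (j, n) := i in
  match j with
  | Im4 => if Z.leb 0 n then 0 else 1
  | Re1 => if Z.leb 0 n then 1 else if Z.eqb n (-1) then 2 else 3
  | Re4 => if Z.leb n (-1) then 0 else if Z.eqb n 0 then 1 else 2
  | Re2 | Re5 => 4
  | Im1 | Diff1 | Diff4 => 0
  end.

Lemma level_le_4 i : (level i <= 4)%nat.
Proof. destruct i as [[] n]; simpl; split_on_sites; lia. Qed.

Definition slack : R := rho * (1 - rho) / 2.

Definition level_gain : R := B ^ 4 / (rho ^ 2 * slack).

Local Notation K := level_gain.

Definition weight (i : index) : R := K ^ level i * rho ^ Z.abs_nat (snd i).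

Lemma pow2_rho_range : 0 < rho ^ 2 < rho.
Proof. simpl. nra. Qed.

Lemma slack_range : 0 < slack < rho.
Proof. unfold slack. nra. Qed.

Lemma level_gain_ge_1 : 1 <= K.
Proof.
  assert (Hr := pow2_rho_range). assert (Hs := slack_range).
  assert (HB : 1 <= B ^ 4) by (apply pow_R1_Rle; lra).
  apply Rle_div_r; nra.
Qed.

Lemma weight_pos i : 0 < weight i.
Proof.
  assert (HK := level_gain_ge_1). apply Rmult_lt_0_compat; apply pow_lt; lra.
Qed.

Lemma weight_near d p q i j : (level j + p <= level i + q)%nat ->
  (Z.abs (snd i - snd j) <= Z.of_nat d)%Z ->
  K ^ p * weight j <= K ^ q * (/ rho ^ d * weight i).
Proof.
  intros Hlev Hij. assert (HK := level_gain_ge_1).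
  replace (K ^ p * weight j) with (K ^ (level j + p) * rho ^ Z.abs_nat (snd j))
    by (unfold weight; rewrite pow_add; ring).
  replace (K ^ q * (/ rho ^ d * weight i)) with
    (K ^ (level i + q) * (/ rho ^ d * rho ^ Z.abs_nat (snd i)))
    by (unfold weight; rewrite pow_add; ring).
  apply Rmult_le_compat; [apply pow_le; lra|apply pow_le; lra| |now apply pow_abs_near].
  now apply Rle_pow.
Qed.

Lemma same_level_entry_le t i j a : Rabs a <= t * rho ^ 4 -> 0 <= t ->
  (level j <= level i)%nat -> (Z.abs (snd i - snd j) <= 2)%Z ->
  Rabs a * weight j <= t * rho ^ 2 * weight i.
Proof.
  intros Ha Ht Hlev Hij.
  assert (Hnear := weight_near 2 0 0 i j ltac:(lia) Hij). rewrite !pow_O, !Rmult_1_l in Hnear.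
  assert (Hj := weight_pos j).
  apply Rle_trans with (t * rho ^ 4 * (/ rho ^ 2 * weight i)).
  - apply Rmult_le_compat; trivial; [apply Rabs_pos|lra].
  - right. field. lra.
Qed.

Lemma lower_level_entry_le i j a : Rabs a <= B ^ 4 ->
  (level j < level i)%nat -> (Z.abs (snd i - snd j) <= 2)%Z ->
  Rabs a * weight j <= slack * weight i.
Proof.
  intros Ha Hlev Hij. assert (Hs := slack_range). assert (Hr := pow2_rho_range).
  assert (HK := level_gain_ge_1). assert (Hj := weight_pos j).
  assert (Hnear := weight_near 2 1 0 i j ltac:(lia) Hij). rewrite pow_O, pow_1, Rmult_1_l in Hnear.
  assert (HB : B ^ 4 = slack * rho ^ 2 * K) by (unfold level_gain; field; lra).
  apply Rle_trans with (slack * rho ^ 2 * (K * weight j)).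
  - replace (slack * rho ^ 2 * (K * weight j)) with (B ^ 4 * weight j) by (rewrite HB; ring).
    apply Rmult_le_compat_r; lra.
  - apply Rle_trans with (slack * rho ^ 2 * (/ rho ^ 2 * weight i)).
    + apply Rmult_le_compat_l; [nra|trivial].
    + right. field. lra.
Qed.

Lemma row_norm_nil_le i : row_norm weight [] <= rho * weight i.
Proof. simpl. assert (H := weight_pos i). nra. Qed.

Lemma row_norm_singleton_same_level i j a : Rabs a <= rho ^ 4 ->
  (level j <= level i)%nat -> (Z.abs (snd i - snd j) <= 2)%Z ->
  row_norm weight [(a, j)] <= rho * weight i.
Proof.
  intros Ha Hlev Hij. assert (Hr := pow2_rho_range). assert (Hi := weight_pos i).
  assert (H := same_level_entry_le 1 i j a ltac:(lra) ltac:(lra) Hlev Hij). simpl in *. nra.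
Qed.

Lemma row_norm_singleton_lower_level i j a : Rabs a <= B ^ 4 ->
  (level j < level i)%nat -> (Z.abs (snd i - snd j) <= 2)%Z ->
  row_norm weight [(a, j)] <= rho * weight i.
Proof.
  intros Ha Hlev Hij. assert (Hs := slack_range). assert (Hi := weight_pos i).
  assert (H := lower_level_entry_le i j a Ha Hlev Hij). simpl in *. nra.
Qed.

Lemma row_norm_pair_same_level i j j' a a' :
  Rabs a <= / 2 * rho ^ 4 -> Rabs a' <= / 2 * rho ^ 4 ->
  (level j <= level i)%nat -> (level j' <= level i)%nat ->
  (Z.abs (snd i - snd j) <= 2)%Z -> (Z.abs (snd i - snd j') <= 2)%Z ->
  row_norm weight [(a, j); (a', j')] <= rho * weight i.
Proof.
  intros Ha Ha' Hlev Hlev' Hij Hij'. assert (Hr := pow2_rho_range). assert (Hi := weight_pos i).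
  assert (H := same_level_entry_le (/ 2) i j a Ha ltac:(lra) Hlev Hij).
  assert (H' := same_level_entry_le (/ 2) i j' a' Ha' ltac:(lra) Hlev' Hij').
  simpl in *. nra.
Qed.

Lemma row_norm_pair_lower_level i j j' a a' : Rabs a <= B ^ 4 -> Rabs a' <= B ^ 4 ->
  (level j < level i)%nat -> (level j' < level i)%nat ->
  (Z.abs (snd i - snd j) <= 2)%Z -> (Z.abs (snd i - snd j') <= 2)%Z ->
  row_norm weight [(a, j); (a', j')] <= rho * weight i.
Proof.
  intros Ha Ha' Hlev Hlev' Hij Hij'. assert (Hi := weight_pos i).
  assert (H := lower_level_entry_le i j a Ha Hlev Hij).
  assert (H' := lower_level_entry_le i j' a' Ha' Hlev' Hij').
  assert (2 * slack <= rho) by (unfold slack; nra). simpl. nra.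
Qed.

Lemma row_norm_pair_mixed_level i j j' a a' : Rabs a <= rho ^ 4 -> Rabs a' <= B ^ 4 ->
  (level j <= level i)%nat -> (level j' < level i)%nat ->
  (Z.abs (snd i - snd j) <= 2)%Z -> (Z.abs (snd i - snd j') <= 2)%Z ->
  row_norm weight [(a, j); (a', j')] <= rho * weight i.
Proof.
  intros Ha Ha' Hlev Hlev' Hij Hij'. assert (Hi := weight_pos i).
  assert (H := same_level_entry_le 1 i j a ltac:(lra) ltac:(lra) Hlev Hij).
  assert (H' := lower_level_entry_le i j' a' Ha' Hlev' Hij').
  assert (rho ^ 2 + slack <= rho) by (unfold slack; simpl; nra). simpl in *. nra.
Qed.

Lemma inv_bounds u : / B <= u <= B -> 0 < / u <= B.
Proof.
  intros Hu. assert (HB : 0 < / B) by (apply Rinv_0_lt_compat; lra).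
  split; [apply Rinv_0_lt_compat; lra|].
  rewrite <- (Rinv_inv B). apply Rinv_le_contravar; lra.
Qed.

Lemma ratio_range u w : / B <= u <= B -> / B <= w <= B -> 0 < u / w <= B ^ 2.
Proof.
  intros Hu Hw. assert (HB : 0 < / B) by (apply Rinv_0_lt_compat; lra).
  assert (Hw' := inv_bounds w Hw). simpl. rewrite Rmult_1_r.
  split; [apply Rmult_lt_0_compat|apply Rmult_le_compat]; lra.
Qed.

Lemma inv_coef_m_range n : 0 < / mn n <= B ^ 3.
Proof.
  assert (Hb := coef_b_pos n). assert (Hb' := coef_b_pos (n + 2)). assert (Hd := coef_d_pos n).
  split; [apply Rinv_0_lt_compat, coef_m_pos|].
  replace (/ mn n) with (dn n / bn n * (/ bn (n + 2)) / 2) by (unfold coef_m; field; lra).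
  assert (Hr := ratio_range _ _ (coef_d_bounds n) (coef_b_bounds n)).
  assert (Hi := inv_bounds _ (coef_b_bounds (n + 2))).
  assert (dn n / bn n * (/ bn (n + 2)) <= B ^ 2 * B) by (apply Rmult_le_compat; lra).
  assert (0 < dn n / bn n * (/ bn (n + 2))) by (apply Rmult_lt_0_compat; lra).
  simpl in *. lra.
Qed.

Lemma B_pow4_lower_bounds : 1 <= B ^ 4 /\ 2 * B ^ 2 <= B ^ 4.
Proof.
  assert (H : 4 <= B ^ 2) by (simpl; nra).
  replace (B ^ 4) with (B ^ 2 * B ^ 2) by ring. split; nra.
Qed.

Lemma Rabs_coef_cb_le i n : Rabs (cn i / bn n) <= B ^ 4.
Proof.
  assert (H := ratio_range _ _ (coef_c_bounds i) (coef_b_bounds n)).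
  assert (HB := B_pow4_lower_bounds). apply Rabs_le. lra.
Qed.

Lemma Rabs_coef_bd_le i n : Rabs (- (2 * bn i / dn n)) <= B ^ 4.
Proof.
  assert (H := ratio_range _ _ (coef_b_bounds i) (coef_d_bounds n)).
  assert (HB := B_pow4_lower_bounds).
  replace (2 * bn i / dn n) with (2 * (bn i / dn n)) by (unfold Rdiv; ring).
  apply Rabs_le. lra.
Qed.

Lemma Rabs_div_coef_m_le u n : 0 < u <= B -> Rabs (u / mn n) <= B ^ 4.
Proof.
  intros Hu. assert (Hm := inv_coef_m_range n).
  rewrite Rabs_pos_eq by (apply Rlt_le, Rdiv_lt_0_compat; [lra|apply coef_m_pos]).
  change (B ^ 4) with (B * B ^ 3). apply Rmult_le_compat; lra.
Qed.

Lemma Rabs_coef_bm_le i n : Rabs (bn i / mn n) <= B ^ 4.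
Proof. apply Rabs_div_coef_m_le. split; [apply coef_b_pos|apply coef_b_bounds]. Qed.

Lemma Rabs_coef_cm_le i n : Rabs (cn i / mn n) <= B ^ 4.
Proof. apply Rabs_div_coef_m_le. split; [apply coef_c_pos|apply coef_c_bounds]. Qed.

Lemma Rabs_1_le_pow4 : Rabs 1 <= B ^ 4.
Proof. rewrite Rabs_R1. apply B_pow4_lower_bounds. Qed.

Lemma Rabs_right_rate_le n i : (0 <= n)%Z -> (0 <= i)%Z -> Rabs (bn n / cn i) <= rho ^ 4.
Proof.
  intros Hn Hi. rewrite coef_b_right, coef_c_right by lia.
  rewrite Rabs_pos_eq by (apply Rlt_le, Rdiv_lt_0_compat; lra). lra.
Qed.

Lemma left_rate_range : 0 < (bm + dm) / bm <= rho ^ 4.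
Proof. split; [now apply Rdiv_lt_0_compat|trivial]. Qed.

Lemma Rabs_left_rate_le n i : (n <= -1)%Z -> (i <= -2)%Z -> Rabs (cn i / bn n) <= rho ^ 4.
Proof.
  intros Hn Hi. rewrite coef_b_left, coef_c_left by lia.
  assert (H := left_rate_range). apply Rabs_le. lra.
Qed.

Lemma Rabs_left_coef_bm_le n i : (n <= -3)%Z -> (i <= -1)%Z ->
  Rabs (bn i / mn n) <= / 2 * rho ^ 4.
Proof.
  intros Hn Hi. assert (H := left_rate_range).
  replace (bn i / mn n) with (/ 2 * ((bm + dm) / bm))
    by (unfold coef_m; rewrite !coef_b_left, coef_d_left by lia; field; lra).
  apply Rabs_le. lra.
Qed.

Lemma Rabs_left_coef_cm_le n i : (n <= -3)%Z -> (i <= -2)%Z ->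
  Rabs (cn i / mn n) <= / 2 * rho ^ 4.
Proof.
  intros Hn Hi. assert (H := left_rate_range). set (t := (bm + dm) / bm) in *.
  replace (cn i / mn n) with (/ 2 * (t * t))
    by (unfold t, coef_m; rewrite !coef_b_left, coef_c_left, coef_d_left by lia; field; lra).
  assert (rho ^ 4 <= 1) by (rewrite <- (pow1 4); apply pow_incr; lra).
  apply Rabs_le. split; nra.
Qed.

Ltac compare_levels := simpl; split_on_sites; lia.

Lemma row_norm_propagation_Im4_le n :
  row_norm weight (propagation (Im4, n)) <= rho * weight (Im4, n).
Proof.
  unfold propagation.
  destruct (Z.leb_spec 1 n); [|destruct (Z.eqb_spec n 0); [apply row_norm_nil_le|]].
  - apply row_norm_singleton_same_level; [|compare_levels..]. apply Rabs_right_rate_le; lia.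
  - destruct (Z.eq_dec n (-1)).
    + apply row_norm_singleton_lower_level; [|compare_levels..]. apply Rabs_coef_cb_le.
    + apply row_norm_singleton_same_level; [|compare_levels..]. apply Rabs_left_rate_le; lia.
Qed.

Lemma row_norm_propagation_Im1_le n :
  row_norm weight (propagation (Im1, n)) <= rho * weight (Im1, n).
Proof.
  unfold propagation.
  destruct (Z.leb_spec 0 n); (apply row_norm_singleton_same_level; [|compare_levels..]).
  - apply Rabs_right_rate_le; lia.
  - apply Rabs_left_rate_le; lia.
Qed.

Lemma Rabs_zeta_le : Rabs zeta <= rho ^ 4.
Proof. apply Rabs_le; lra. Qed.

Lemma Rabs_omega_le : Rabs omega <= rho ^ 4.
Proof. apply Rabs_le; lra. Qed.

Lemma row_norm_propagation_Re1_le n :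
  row_norm weight (propagation (Re1, n)) <= rho * weight (Re1, n).
Proof.
  unfold propagation.
  destruct (Z.leb_spec 1 n); [|destruct (Z.eqb_spec n 0); [apply row_norm_nil_le|]].
  - apply row_norm_pair_mixed_level; [| |compare_levels..].
    + apply Rabs_zeta_le.
    + apply Rabs_1_le_pow4.
  - destruct (Z_lt_le_dec n (-2)).
    + apply row_norm_pair_same_level; [| |compare_levels..].
      * apply Rabs_left_coef_bm_le; lia.
      * apply Rabs_left_coef_cm_le; lia.
    + apply row_norm_pair_lower_level; [| |compare_levels..].
      * apply Rabs_coef_bm_le.
      * apply Rabs_coef_cm_le.
Qed.

Lemma row_norm_propagation_Re4_le n :
  row_norm weight (propagation (Re4, n)) <= rho * weight (Re4, n).
Proof.
  unfold propagation. destruct (Z.leb_spec 2 n).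
  - apply row_norm_pair_mixed_level; [| |compare_levels..].
    + apply Rabs_omega_le.
    + apply Rabs_1_le_pow4.
  - destruct (Z_lt_le_dec n 0).
    + apply row_norm_pair_same_level; [| |compare_levels..].
      * apply Rabs_left_coef_bm_le; lia.
      * apply Rabs_left_coef_cm_le; lia.
    + apply row_norm_pair_lower_level; [| |compare_levels..].
      * apply Rabs_coef_bm_le.
      * apply Rabs_coef_cm_le.
Qed.

Lemma row_norm_propagation_le i : row_norm weight (propagation i) <= rho * weight i.
Proof.
  destruct i as [[] n].
  - apply row_norm_propagation_Re1_le.
  - apply row_norm_propagation_Im1_le.
  - apply row_norm_singleton_lower_level; [|compare_levels..]. apply Rabs_coef_bd_le.
  - apply row_norm_propagation_Re4_le.
  - apply row_norm_propagation_Im4_le.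
  - apply row_norm_singleton_lower_level; [|compare_levels..]. apply Rabs_coef_bd_le.
  - unfold propagation. destruct (Z.leb_spec 1 n); [|apply row_norm_nil_le].
    apply row_norm_singleton_same_level; [|compare_levels..]. apply Rabs_omega_le.
  - unfold propagation. destruct (Z.leb_spec 1 n); [|apply row_norm_nil_le].
    apply row_norm_singleton_same_level; [|compare_levels..]. apply Rabs_zeta_le.
Qed.

Definition param_size (E s v : R) : R := Rabs E + Rabs s + Rabs v.

Lemma param_size_nonneg E s v : 0 <= param_size E s v.
Proof.
  assert (HE := Rabs_pos E). assert (Hs := Rabs_pos s). assert (Hv := Rabs_pos v).
  unfold param_size. lra.
Qed.

Definition source_gain : R := 4 * B ^ 2 * K ^ 4 / rho ^ 4.

Lemma source_gain_pos : 0 < source_gain.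
Proof.
  assert (HK := level_gain_ge_1). apply Rdiv_lt_0_compat; [|apply pow_lt; lra].
  apply Rmult_lt_0_compat; [simpl; nra|apply pow_lt; lra].
Qed.

Lemma row_norm_near_le i C r : 0 <= C ->
  Forall (fun e => Rabs (fst e) <= C /\ (Z.abs (snd i - snd (snd e)) <= 4)%Z) r ->
  row_norm weight r <= INR (length r) * (C * (K ^ 4 * / rho ^ 4 * weight i)).
Proof.
  intros HC Hr. assert (Hi := weight_pos i).
  induction Hr as [|[a j] r [Ha Hj] _ IH]; [simpl; lra|].
  cbn [row_norm fold_right fst snd length] in *. rewrite S_INR.
  assert (Rabs a * weight j <= C * (K ^ 4 * / rho ^ 4 * weight i)).
  { apply Rmult_le_compat; [apply Rabs_pos|apply Rlt_le, weight_pos|trivial|].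
    rewrite Rmult_assoc, <- (Rmult_1_l (weight j)). apply (weight_near 4 0 4); [|trivial].
    assert (Hlev := level_le_4 j). lia. }
  change (fold_right _ 0 r) with (row_norm weight r). lra.
Qed.

Lemma source_entries E s v j n :
  Forall (fun e => Rabs (fst e) <= B ^ 2 * param_size E s v /\
    (Z.abs (snd (snd e) - n) <= 2)%Z) (source E s v j n).
Proof.
  assert (Hsize := param_size_nonneg E s v).
  assert (HE := Rabs_pos E). assert (Hs := Rabs_pos s). assert (Hv := Rabs_pos v).
  assert (HB : B <= B ^ 2 /\ 1 <= B ^ 2) by (simpl; split; nra).
  assert (plain : Rabs E <= B ^ 2 * param_size E s v) by (unfold param_size in *; nra).
  assert (scaled : forall u g, Rabs u <= param_size E s v -> 0 < g <= B ^ 2 ->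
    Rabs (u * g) <= B ^ 2 * param_size E s v).
  { intros u g Hu Hg. rewrite Rabs_mult, (Rabs_pos_eq g), Rmult_comm by lra.
    apply Rmult_le_compat; trivial; [lra|apply Rabs_pos|lra]. }
  assert (Hc : forall m, 0 < cn m <= B ^ 2).
  { intros m. split; [apply coef_c_pos|]. assert (H := coef_c_bounds m). lra. }
  assert (Hbd : forall m m', 0 < bn m / dn m' <= B ^ 2).
  { intros m m'. exact (ratio_range _ _ (coef_b_bounds m) (coef_d_bounds m')). }
  assert (sizes : Rabs s <= param_size E s v /\ Rabs v <= param_size E s v /\
    Rabs (- v) <= param_size E s v /\ Rabs (- E) <= param_size E s v)
    by (rewrite !Rabs_Ropp; unfold param_size; lra).
  destruct sizes as [Hs' [Hv' [Hv'' HE']]].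
  destruct j; unfold source; repeat (apply Forall_cons; [split|]); simpl; try lia; auto.
Qed.

Lemma row_norm_source_le E s v j n i : (Z.abs (snd i - n) <= 2)%Z ->
  row_norm weight (source E s v j n) <= source_gain * param_size E s v * weight i.
Proof.
  intros Hi. assert (Hsize := param_size_nonneg E s v). set (P := param_size E s v) in *.
  assert (HBP : 0 <= B ^ 2 * P) by (apply Rmult_le_pos; [apply pow2_ge_0|trivial]).
  assert (HK := level_gain_ge_1).
  assert (HW : 0 <= K ^ 4 * / rho ^ 4 * weight i).
  { assert (Hw := weight_pos i). apply Rmult_le_pos; [apply Rmult_le_pos|lra];
      [apply pow_le; lra|apply Rlt_le, Rinv_0_lt_compat, pow_lt; lra]. }
  apply Rle_trans with (INR (length (source E s v j n))
    * (B ^ 2 * P * (K ^ 4 * / rho ^ 4 * weight i))).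
  - apply row_norm_near_le; [trivial|].
    apply Forall_impl with (2 := source_entries E s v j n). intros e [Ha He]. split; [trivial|lia].
  - replace (source_gain * P * weight i) with (INR 4 * (B ^ 2 * P * (K ^ 4 * / rho ^ 4 * weight i)))
      by (unfold source_gain; simpl; field; lra).
    apply Rmult_le_compat_r; [now apply Rmult_le_pos|]. apply le_INR.
    destruct j; simpl; lia.
Qed.

Definition forcing_gain : R := B ^ 3 * source_gain.

Lemma forcing_gain_pos : 0 < forcing_gain.
Proof. apply Rmult_lt_0_compat; [apply pow_lt; lra|apply source_gain_pos]. Qed.

Lemma row_norm_scaled_source_le E s v g j n i : Rabs g <= B ^ 3 -> (Z.abs (snd i - n) <= 2)%Z ->
  row_norm weight (row_scale g (source E s v j n))
    <= forcing_gain * param_size E s v * weight i.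
Proof.
  intros Hg Hn. rewrite row_norm_scale.
  replace (forcing_gain * param_size E s v * weight i) with
    (B ^ 3 * (source_gain * param_size E s v * weight i)) by (unfold forcing_gain; ring).
  assert (Hi := weight_pos i). assert (Hsize := param_size_nonneg E s v).
  assert (HG := source_gain_pos).
  apply Rle_trans with (Rabs g * (source_gain * param_size E s v * weight i)).
  - apply Rmult_le_compat_l; [apply Rabs_pos|now apply row_norm_source_le].
  - apply Rmult_le_compat_r; [|trivial]. apply Rmult_le_pos; [apply Rmult_le_pos|]; lra.
Qed.

Lemma Rabs_inv_le u : / B <= u <= B -> Rabs (/ u) <= B ^ 3.
Proof.
  intros Hu. assert (H := inv_bounds u Hu). assert (B <= B ^ 3) by (simpl; nra).
  apply Rabs_le. lra.
Qed.

Lemma Rabs_div_le_of_inv a u : Rabs a <= 1 -> Rabs (/ u) <= B ^ 3 -> Rabs (a / u) <= B ^ 3.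
Proof.
  intros Ha Hu. unfold Rdiv. rewrite Rabs_mult, <- (Rmult_1_l (B ^ 3)).
  apply Rmult_le_compat; trivial; apply Rabs_pos.
Qed.

Lemma row_norm_forcing_le E s v i :
  row_norm weight (forcing E s v i) <= forcing_gain * param_size E s v * weight i.
Proof.
  assert (Hi := weight_pos i). assert (Hsize := param_size_nonneg E s v).
  assert (HF := forcing_gain_pos).
  assert (Hnil : row_norm weight [] <= forcing_gain * param_size E s v * weight i)
    by (apply Rmult_le_pos; [apply Rmult_le_pos|]; lra).
  assert (Hb : forall n, Rabs (/ bn n) <= B ^ 3)
    by (intros n; apply Rabs_inv_le, coef_b_bounds).
  assert (Hc : forall n, Rabs (/ cn n) <= B ^ 3)
    by (intros n; apply Rabs_inv_le, coef_c_bounds).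
  assert (Hd : forall n, Rabs (/ dn n) <= B ^ 3)
    by (intros n; apply Rabs_inv_le, coef_d_bounds).
  assert (Hm : forall n, Rabs (/ mn n) <= B ^ 3)
    by (intros n; assert (H := inv_coef_m_range n); apply Rabs_le; lra).
  assert (Hbp : Rabs (/ bp) <= B ^ 3) by (rewrite <- (coef_b_right 0) by lia; apply Hb).
  assert (Hzeta : Rabs zeta <= 1) by (apply Rabs_le; lra).
  assert (Homega : Rabs (- omega) <= 1) by (apply Rabs_le; lra).
  destruct i as [[] n]; unfold forcing; split_on_sites; trivial;
    (apply row_norm_scaled_source_le; [rewrite ?Rabs_Ropp|simpl; lia]);
    auto using Rabs_div_le_of_inv.
Qed.

(** * Solutions of the seeded system *)

Definition contraction_rate : R := (1 + rho) / 2.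

Definition param_radius : R := (1 - rho) / 2 / forcing_gain.

Local Notation lam := contraction_rate.

Lemma contraction_rate_range : 0 <= lam < 1.
Proof. unfold lam. lra. Qed.

Lemma param_radius_pos : 0 < param_radius.
Proof. apply Rdiv_lt_0_compat; [lra|apply forcing_gain_pos]. Qed.

Lemma sweep_contracts E s v i : param_size E s v <= param_radius ->
  row_norm weight (sweep E s v i) <= lam * weight i.
Proof.
  intros Hsize. assert (HF := forcing_gain_pos). assert (Hi := weight_pos i).
  unfold sweep. rewrite row_norm_app.
  assert (Hprop := row_norm_propagation_le i). assert (Hforc := row_norm_forcing_le E s v i).
  assert (forcing_gain * param_size E s v <= (1 - rho) / 2).
  { replace ((1 - rho) / 2) with (forcing_gain * param_radius) by (unfold param_radius; field; lra).
    apply Rmult_le_compat_l; lra. }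
  unfold lam. nra.
Qed.

Definition unit_seed (t1 t2 : R) : Prop := Rabs t1 <= 1 /\ Rabs t2 <= 1.

Lemma unit_seed_10 : unit_seed 1 0.
Proof. split; [rewrite Rabs_R1|rewrite Rabs_R0]; lra. Qed.

Lemma unit_seed_01 : unit_seed 0 1.
Proof. split; [rewrite Rabs_R0|rewrite Rabs_R1]; lra. Qed.

Lemma wbounded_seed t1 t2 : unit_seed t1 t2 -> wbounded weight 1 (seed t1 t2).
Proof.
  intros [Ht1 Ht2] i. rewrite Rmult_1_l. assert (Hi := weight_pos i).
  assert (HK := level_gain_ge_1).
  destruct i as [[] n]; unfold seed; try (rewrite Rabs_R0; lra);
    (destruct (Z.eqb_spec n 0) as [-> |]; [|rewrite Rabs_R0; lra]); unfold weight; simpl; lra.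
Qed.

Definition sol (t1 t2 E s v : R) : state := neumann (sweep E s v) (seed t1 t2).

Definition sol_bound : R := / (1 - lam).

Lemma sol_bound_pos : 0 < sol_bound.
Proof. assert (H := contraction_rate_range). apply Rinv_0_lt_compat. lra. Qed.

Lemma sol_fixed_point t1 t2 E s v : unit_seed t1 t2 -> param_size E s v <= param_radius ->
  sweep_fixed_point E s v t1 t2 (sol t1 t2 E s v).
Proof.
  intros Ht Hsize i.
  apply neumann_fixed_point with (W := weight) (lam := lam) (M := 1);
    auto using contraction_rate_range, sweep_contracts, wbounded_seed, Rle_0_1.
Qed.

Lemma wbounded_sol t1 t2 E s v : unit_seed t1 t2 -> param_size E s v <= param_radius ->
  wbounded weight sol_bound (sol t1 t2 E s v).
Proof.
  intros Ht Hsize. replace sol_bound with (1 / (1 - lam)) by apply Rdiv_1_l.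
  apply wbounded_neumann;
    auto using contraction_rate_range, sweep_contracts, wbounded_seed, Rle_0_1.
Qed.

Definition sol_lipschitz_const : R := forcing_gain * sol_bound ^ 2.

Local Notation Lip := sol_lipschitz_const.

Lemma sol_lipschitz_const_pos : 0 < Lip.
Proof.
  apply Rmult_lt_0_compat; [apply forcing_gain_pos|apply pow_lt, sol_bound_pos].
Qed.

Lemma sol_lipschitz t1 t2 E s v E' s' v' : unit_seed t1 t2 ->
  param_size E s v <= param_radius -> param_size E' s' v' <= param_radius ->
  wbounded weight (Lip * param_size (E - E') (s - s') (v - v'))
    (fun i => sol t1 t2 E s v i - sol t1 t2 E' s' v' i).
Proof.
  intros Ht Hsize Hsize'. set (P := param_size (E - E') (s - s') (v - v')).
  assert (HPn : 0 <= P) by apply param_size_nonneg.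
  assert (HF := forcing_gain_pos). assert (HM := sol_bound_pos).
  replace (Lip * P) with (sol_bound * (forcing_gain * P) / (1 - lam))
    by (unfold sol_lipschitz_const, sol_bound; field; assert (H := contraction_rate_range); lra).
  apply neumann_lipschitz with (W := weight) (M := 1);
    auto using contraction_rate_range, sweep_contracts, wbounded_seed, Rle_0_1.
  - intros i. apply Rlt_le, weight_pos.
  - apply Rmult_le_pos; [lra|]. apply Rmult_le_pos; lra.
  - intros i. rewrite sweep_minus.
    apply Rle_trans with (1 := Rabs_row_eval _ _ _ _ (wbounded_sol t1 t2 E' s' v' Ht Hsize')).
    rewrite Rmult_assoc. apply Rmult_le_compat_l; [lra|apply row_norm_forcing_le].
Qed.

Lemma sol_continuous t1 t2 E s v i : unit_seed t1 t2 -> param_size E s v < param_radius ->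
  continuity_pt (fun E => sol t1 t2 E s v i) E.
Proof.
  intros Ht Hsize.
  apply continuity_pt_lipschitz with (param_radius - param_size E s v) (Lip * weight i); [lra| |].
  - apply Rlt_le, Rmult_lt_0_compat; [apply sol_lipschitz_const_pos|apply weight_pos].
  - intros E' HE'.
    assert (Hsize' : param_size E' s v <= param_radius).
    { assert (H := Rabs_triang (E' - E) E). replace (E' - E + E) with E' in H by ring.
      unfold param_size in *. lra. }
    apply Rle_trans with (1 := sol_lipschitz t1 t2 E' s v E s v Ht Hsize' (Rlt_le _ _ Hsize) i).
    unfold param_size. rewrite !Rminus_diag, !Rabs_R0, !Rplus_0_r. lra.
Qed.

(** * Zero modes *)

Local Notation mode_phi := (sol 1 0 0 0 0).
Local Notation mode_psi := (sol 0 1 0 0 0).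

Lemma param_size_0 : param_size 0 0 0 <= param_radius.
Proof. assert (H := param_radius_pos). unfold param_size. rewrite Rabs_R0. lra. Qed.

Lemma forcing_0 i : Forall (fun e => fst e = 0) (forcing 0 0 0 i).
Proof.
  destruct i as [[] n]; unfold forcing; split_on_sites; repeat constructor; simpl; ring.
Qed.

Lemma zero_mode_follows_sign t1 t2 (sigma : index -> R) : unit_seed t1 t2 ->
  (forall i, follows_sign (sigma i) (seed t1 t2 i)) ->
  (forall i, Forall (fun e => follows_sign (sigma i) (fst e * sigma (snd e))) (propagation i)) ->
  forall i, follows_sign (sigma i) (sol t1 t2 0 0 0 i).
Proof.
  intros Ht Hseed Hprop.
  apply neumann_follows_sign with (W := weight) (lam := lam) (M := 1);
    auto using contraction_rate_range, sweep_contracts, wbounded_seed, Rle_0_1, param_size_0.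
  intros i. apply Forall_app. split; [apply Hprop|].
  apply Forall_impl with (2 := forcing_0 i). intros e ->.
  split; [lra|intros _; ring].
Qed.

Lemma coef_ratio_pos n m : 0 < bn n / cn m /\ 0 < cn n / bn m /\ 0 < bn n / mn m /\
  0 < cn n / mn m /\ 0 < 2 * bn n / dn m.
Proof.
  assert (Hb := coef_b_pos n). assert (Hb2 : 0 < 2 * bn n) by lra.
  repeat split; apply Rdiv_lt_0_compat;
    auto using coef_b_pos, coef_c_pos, coef_d_pos, coef_m_pos.
Qed.

Ltac check_signs :=
  intros [[] n]; unfold propagation; split_on_sites;
  repeat (apply Forall_cons;
    [apply follows_sign_mul_0 || apply follows_sign_pos_mul_1 || apply follows_sign_neg_mul_1|]);
  try apply Forall_nil; simpl; try lra; apply Rlt_le, coef_ratio_pos.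

Lemma mode_phi_follows_sign i :
  follows_sign (match fst i with Im4 => 1 | _ => 0 end) (mode_phi i).
Proof.
  apply (zero_mode_follows_sign 1 0 (fun i => match fst i with Im4 => 1 | _ => 0 end)).
  - exact unit_seed_10.
  - intros [[] n]; simpl; split; try destruct (Z.eqb n 0); lra.
  - check_signs.
Qed.

Lemma mode_psi_follows_sign i :
  follows_sign (match fst i with Re1 => 1 | Re2 => -1 | _ => 0 end) (mode_psi i).
Proof.
  apply (zero_mode_follows_sign 0 1
    (fun i => match fst i with Re1 => 1 | Re2 => -1 | _ => 0 end)).
  - exact unit_seed_01.
  - intros [[] n]; simpl; split; try destruct (Z.eqb n 0); lra.
  - check_signs.
Qed.

Definition phi (n : Z) : R := mode_phi (Im4, n).

Definition psi (n : Z) : R := mode_psi (Re1, n).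

Lemma phi_nonneg n : 0 <= phi n.
Proof. destruct (mode_phi_follows_sign (Im4, n)) as [H _]. unfold phi. simpl in H. lra. Qed.

Lemma psi_nonneg n : 0 <= psi n.
Proof. destruct (mode_psi_follows_sign (Re1, n)) as [H _]. unfold psi. simpl in H. lra. Qed.

Lemma mode_phi_support j n : j <> Im4 -> mode_phi (j, n) = 0.
Proof. intros Hj. destruct (mode_phi_follows_sign (j, n)) as [_ H]. now apply H; destruct j. Qed.

Lemma mode_psi_support j n : j <> Re1 -> j <> Re2 -> mode_psi (j, n) = 0.
Proof.
  intros Hj Hj'. destruct (mode_psi_follows_sign (j, n)) as [_ H]. now apply H; destruct j.
Qed.

Lemma mode_phi_fixed_point : sweep_fixed_point 0 0 0 1 0 mode_phi.
Proof. apply sol_fixed_point; [exact unit_seed_10|exact param_size_0]. Qed.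

Lemma mode_psi_fixed_point : sweep_fixed_point 0 0 0 0 1 mode_psi.
Proof. apply sol_fixed_point; [exact unit_seed_01|exact param_size_0]. Qed.

Lemma phi_0 : phi 0 = 1.
Proof. exact (fixed_point_Im4_0 _ _ _ _ _ _ mode_phi_fixed_point). Qed.

Lemma psi_0 : psi 0 = 1.
Proof. exact (fixed_point_Re1_0 _ _ _ _ _ _ mode_psi_fixed_point). Qed.

Lemma source_0 j n x : row_eval (source 0 0 0 j n) x = 0.
Proof. destruct j; cbn [source row_eval fold_right fst snd]; ring. Qed.

Lemma phi_kernel n : two_step bn (fun n => - cn n) (fun _ => 0) phi n = 0.
Proof.
  transitivity (row_eval (source 0 0 0 Im4 n) mode_phi); [|apply source_0].
  exact (balance_Im4 _ _ _ _ _ _ mode_phi_fixed_point n).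
Qed.

Lemma psi_kernel n : two_step_adjoint bn cn (fun n => - mn n) psi n = 0.
Proof.
  transitivity (row_eval (source 0 0 0 Re1 n) mode_psi); [|apply source_0].
  exact (balance_Re1 _ _ _ _ _ _ mode_psi_fixed_point n).
Qed.

Lemma mode_psi_Re2 n : dn n * mode_psi (Re2, n + 2)%Z = - (2 * bn n * psi n).
Proof.
  assert (H := balance_Re2 _ _ _ _ _ _ mode_psi_fixed_point n). rewrite source_0 in H.
  unfold balance in H. unfold psi. lra.
Qed.

Lemma wbounded_weight_nonneg M x : wbounded weight M x -> 0 <= M.
Proof.
  intros Hx. assert (H := Hx (Im1, 0%Z)). assert (H' := Rabs_pos (x (Im1, 0%Z))).
  unfold weight in H. simpl in H. lra.
Qed.

Lemma wbounded_decays M x j : wbounded weight M x ->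
  decays rho (M * K ^ 4) (fun n => x (j, n)).
Proof.
  intros Hx n. apply Rle_trans with (1 := Hx (j, n)). rewrite Rmult_assoc.
  apply Rmult_le_compat_l; [exact (wbounded_weight_nonneg M x Hx)|]. unfold weight. cbn [snd].
  apply Rmult_le_compat_r; [apply pow_le; lra|].
  apply Rle_pow; [apply level_gain_ge_1|apply level_le_4].
Qed.

Definition mode_bound : R := sol_bound * K ^ 4.

Lemma mode_bound_pos : 0 < mode_bound.
Proof.
  apply Rmult_lt_0_compat; [apply sol_bound_pos|apply pow_lt].
  assert (H := level_gain_ge_1). lra.
Qed.

Lemma decays_mode_psi j : decays rho mode_bound (fun n => mode_psi (j, n)).
Proof. apply wbounded_decays, wbounded_sol; [exact unit_seed_01|exact param_size_0]. Qed.

Lemma decays_phi : decays rho mode_bound phi.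
Proof.
  apply (wbounded_decays sol_bound mode_phi Im4), wbounded_sol;
    [exact unit_seed_10|exact param_size_0].
Qed.

Lemma decays_psi : decays rho mode_bound psi.
Proof. exact (decays_mode_psi Re1). Qed.

(** * Pairings with the zero modes *)

Definition pairing (y : Z -> R) (j : component) (E s v : R) (x : state) : R :=
  Zsum (fun n => y n * row_eval (source E s v j n) x).

Lemma decays_pairing_term Y y M x j E s v : decays rho Y y -> wbounded weight M x ->
  decays rho (Y * (M * (source_gain * param_size E s v)))
    (fun n => y n * row_eval (source E s v j n) x).
Proof.
  intros Hy Hx n. assert (Hsize := param_size_nonneg E s v). assert (HG := source_gain_pos).
  assert (Hpow : 0 <= rho ^ Z.abs_nat n <= 1).
  { split; [apply pow_le; lra|]. apply (pow_antitone rho rho_range 0). lia. }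
  assert (Hsrc : Rabs (row_eval (source E s v j n) x) <= M * (source_gain * param_size E s v)).
  { apply Rle_trans with (1 := Rabs_row_eval _ _ _ _ Hx).
    apply Rmult_le_compat_l; [exact (wbounded_weight_nonneg M x Hx)|].
    apply Rle_trans with (1 := row_norm_source_le E s v j n (Im1, n) ltac:(simpl; lia)).
    unfold weight. cbn [level snd]. rewrite pow_O, Rmult_1_l.
    rewrite <- (Rmult_1_r (source_gain * _)) at 2.
    apply Rmult_le_compat_l; [apply Rmult_le_pos; lra|lra]. }
  rewrite Rabs_mult.
  replace (Y * (M * (source_gain * param_size E s v)) * rho ^ Z.abs_nat n) with
    (Y * rho ^ Z.abs_nat n * (M * (source_gain * param_size E s v))) by ring.
  apply Rmult_le_compat; trivial; apply Rabs_pos.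
Qed.

Lemma Zsummable_pairing_term Y y M x j E s v : decays rho Y y -> wbounded weight M x ->
  Zsummable (fun n => y n * row_eval (source E s v j n) x).
Proof.
  intros Hy Hx.
  exact (decays_Zsummable rho rho_range _ _ (decays_pairing_term Y y M x j E s v Hy Hx)).
Qed.

Lemma Rabs_pairing_le Y y M x j E s v : decays rho Y y -> wbounded weight M x ->
  Rabs (pairing y j E s v x)
    <= Y * (M * (source_gain * param_size E s v)) * Zsum (fun n => rho ^ Z.abs_nat n).
Proof. intros Hy Hx. apply decays_Rabs_Zsum_le; [trivial|]. now apply decays_pairing_term. Qed.

Lemma pairing_minus Y y M x x' j E s v : decays rho Y y ->
  wbounded weight M x -> wbounded weight M x' ->
  pairing y j E s v x - pairing y j E s v x' = pairing y j E s v (fun i => x i - x' i).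
Proof.
  intros Hy Hx Hx'. unfold pairing.
  rewrite <- Zsum_minus by (eapply Zsummable_pairing_term; eassumption).
  apply Zsum_ext. intros n. rewrite row_eval_minus. ring.
Qed.

Lemma coef_m_le n : mn n <= 2 * B ^ 3.
Proof.
  assert (Hd := coef_d_pos n). assert (Hb := coef_b_pos (n + 2)).
  assert (Hb' := coef_b_bounds (n + 2)).
  assert (Hr := ratio_range _ _ (coef_b_bounds n) (coef_d_bounds n)).
  replace (mn n) with (2 * (bn n / dn n * bn (n + 2))) by (unfold coef_m; field; lra).
  assert (bn n / dn n * bn (n + 2) <= B ^ 2 * B) by (apply Rmult_le_compat; lra).
  simpl in *. lra.
Qed.

Lemma Rabs_coef_le n : Rabs (bn n) <= 2 * B ^ 3 /\ Rabs (cn n) <= 2 * B ^ 3 /\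
  Rabs (- cn n) <= 2 * B ^ 3 /\ Rabs (- mn n) <= 2 * B ^ 3.
Proof.
  assert (HB : B <= 2 * B ^ 3) by (simpl; nra).
  assert (Hb := coef_b_pos n). assert (Hb' := coef_b_bounds n).
  assert (Hc := coef_c_pos n). assert (Hc' := coef_c_bounds n).
  assert (Hm := coef_m_pos n). assert (Hm' := coef_m_le n).
  rewrite !Rabs_Ropp, !Rabs_pos_eq by lra. lra.
Qed.

Lemma defect_eq_pairing j y Y E s v x M : decays rho Y y -> y 0%Z = 1 ->
  wbounded weight M x ->
  (forall n, n <> 0%Z -> balance j x n = row_eval (source E s v j n) x) ->
  Zsum (fun n => y n * balance j x n) = 0 ->
  - defect E s v j x = pairing y j E s v x.
Proof.
  intros Hy Hy0 Hx Hbal Hz.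
  rewrite (Zsum_eq_off_0 _ (fun n => y n * row_eval (source E s v j n) x)) in Hz.
  - unfold defect, pairing. rewrite Hy0 in Hz. lra.
  - intros n Hn. now rewrite Hbal.
  - exact (Zsummable_pairing_term Y y M x j E s v Hy Hx).
Qed.

Lemma defect_Im1_eq_pairing E s v t1 t2 x M : wbounded weight M x ->
  sweep_fixed_point E s v t1 t2 x ->
  - defect E s v Im1 x = pairing phi Im1 E s v x.
Proof.
  intros Hx Hfix.
  apply defect_eq_pairing with (1 := decays_phi) (2 := phi_0) (3 := Hx).
  - apply balance_Im1 with (1 := Hfix).
  - rewrite (Zsum_ext _ (fun n => balance Im1 x n * phi n)) by (intros; ring).
    unfold balance. rewrite <- (two_step_adjointness (2 * B ^ 3)); try apply Rabs_coef_le.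
    + apply Zsum_zero. intros n. rewrite phi_kernel. ring.
    + intros n. rewrite Rabs_R0. apply Rmult_le_pos; [lra|apply pow_le; lra].
    + exists mode_bound. exact (decays_Rabs_le rho rho_range _ _ decays_phi).
    + exact (decays_Zsummable rho rho_range _ _ (wbounded_decays M x Im1 Hx)).
Qed.

Lemma defect_Re4_eq_pairing E s v t1 t2 x M : wbounded weight M x ->
  sweep_fixed_point E s v t1 t2 x ->
  - defect E s v Re4 x = pairing psi Re4 E s v x.
Proof.
  intros Hx Hfix.
  apply defect_eq_pairing with (1 := decays_psi) (2 := psi_0) (3 := Hx).
  - apply balance_Re4 with (1 := Hfix).
  - unfold balance. rewrite (two_step_adjointness (2 * B ^ 3)); try apply Rabs_coef_le.
    + apply Zsum_zero. intros n. rewrite psi_kernel. ring.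
    + exists (M * K ^ 4). exact (decays_Rabs_le rho rho_range _ _ (wbounded_decays M x Re4 Hx)).
    + exact (decays_Zsummable rho rho_range _ _ decays_psi).
Qed.

Definition norm_phi : R := Zsum (fun n => phi n ^ 2).

Definition norm_psi : R := Zsum (fun n => psi n ^ 2 + / 2 * mode_psi (Re2, n + 2)%Z ^ 2).

Definition overlap : R := Zsum (fun n => psi n * (cn n * phi (n + 1))).

Lemma pairing_phi_mode_phi E s v : pairing phi Im1 E s v mode_phi = E * norm_phi.
Proof.
  unfold pairing, norm_phi. rewrite <- Zsum_scal. apply Zsum_ext. intros n.
  cbn [source row_eval fold_right fst snd].
  rewrite (mode_phi_support Re1), (mode_phi_support Im1) by discriminate.
  change (mode_phi (Im4, n)) with (phi n). ring.
Qed.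

Lemma pairing_psi_mode_phi E s v : pairing psi Re4 E s v mode_phi = s * overlap.
Proof.
  unfold pairing, overlap. rewrite <- Zsum_scal. apply Zsum_ext. intros n.
  cbn [source row_eval fold_right fst snd].
  rewrite (mode_phi_support Re1), (mode_phi_support Re4), (mode_phi_support Re2) by discriminate.
  change (mode_phi (Im4, n + 1)%Z) with (phi (n + 1)). ring.
Qed.

Lemma pairing_psi_mode_psi E s v : pairing psi Re4 E s v mode_psi = E * norm_psi.
Proof.
  unfold pairing, norm_psi. rewrite <- Zsum_scal. apply Zsum_ext. intros n.
  cbn [source row_eval fold_right fst snd].
  rewrite (mode_psi_support Im4), (mode_psi_support Re4) by discriminate.
  change (mode_psi (Re1, n)) with (psi n).
  assert (Hd := coef_d_pos n). assert (Hr := mode_psi_Re2 n).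
  set (r := mode_psi (Re2, n + 2)%Z) in *.
  replace (psi n * (E * psi n + (s * cn n * 0 + (v * cn n * 0 + (- E * (bn n / dn n) * r + 0)))))
    with (E * (psi n ^ 2 + / 2 * (- (2 * bn n * psi n) / dn n * r))) by (field; lra).
  rewrite <- Hr. field. lra.
Qed.

Lemma Zsummable_overlap : Zsummable (fun n => psi n * (cn n * phi (n + 1))).
Proof.
  apply Zsummable_bounded_mult with mode_bound;
    [exact (decays_Rabs_le rho rho_range _ _ decays_psi)|].
  apply Zsummable_bounded_mult with (2 * B ^ 3); [apply Rabs_coef_le|].
  exact (Zsummable_shift 1 phi (decays_Zsummable rho rho_range _ _ decays_phi)).
Qed.

Lemma pairing_phi_mode_psi E s v : pairing phi Im1 E s v mode_psi = s * overlap.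
Proof.
  unfold overlap. rewrite <- (Zsum_shift (-1) _ Zsummable_overlap). unfold pairing.
  rewrite <- Zsum_scal. apply Zsum_ext. intros n.
  cbn [source row_eval fold_right fst snd].
  rewrite (mode_psi_support Im4), (mode_psi_support Im1) by discriminate.
  change (mode_psi (Re1, n - 1)%Z) with (psi (n - 1)).
  replace (n + -1 + 1)%Z with n by lia. replace (n + -1)%Z with (n - 1)%Z by lia. ring.
Qed.

Lemma norm_phi_pos : 0 < norm_phi.
Proof.
  apply Zsum_pos with 0%Z.
  - exact (decays_Zsummable_pow2 rho rho_range _ _ decays_phi).
  - intros n. apply pow2_ge_0.
  - rewrite phi_0. lra.
Qed.

Lemma norm_psi_pos : 0 < norm_psi.
Proof.
  apply Zsum_pos with 0%Z.
  - apply Zsummable_plus; [exact (decays_Zsummable_pow2 rho rho_range _ _ decays_psi)|].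
    apply Zsummable_scal, (Zsummable_shift 2 (fun n => mode_psi (Re2, n) ^ 2)).
    exact (decays_Zsummable_pow2 rho rho_range _ _ (decays_mode_psi Re2)).
  - intros n. assert (H := pow2_ge_0 (psi n)).
    assert (H' := pow2_ge_0 (mode_psi (Re2, n + 2)%Z)). lra.
  - rewrite psi_0. assert (H := pow2_ge_0 (mode_psi (Re2, 0 + 2)%Z)). lra.
Qed.

Lemma overlap_pos : 0 < overlap.
Proof.
  apply Zsum_pos with 0%Z; [exact Zsummable_overlap| |].
  - intros n. apply Rmult_le_pos; [apply psi_nonneg|].
    apply Rmult_le_pos; [apply Rlt_le, coef_c_pos|apply phi_nonneg].
  - assert (H := phi_kernel 0). unfold two_step in H. rewrite phi_0 in H.
    rewrite psi_0. assert (Hb := coef_b_pos 0). lra.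
Qed.

(** * The reduced two-by-two problem *)

Definition pairing_error : R :=
  mode_bound * Lip * source_gain * Zsum (fun n => rho ^ Z.abs_nat n).

Lemma pairing_error_nonneg : 0 <= pairing_error.
Proof.
  assert (HY := mode_bound_pos). assert (HL := sol_lipschitz_const_pos).
  assert (HG := source_gain_pos).
  apply Rmult_le_pos.
  - apply Rmult_le_pos; [apply Rmult_le_pos|]; lra.
  - apply Rlt_le, (Zsum_pos _ 0%Z); [now apply Zsummable_pow_abs| |simpl; lra].
    intros n. apply pow_le. lra.
Qed.

Lemma pairing_sol_near_mode y j t1 t2 E s v : decays rho mode_bound y -> unit_seed t1 t2 ->
  param_size E s v <= param_radius ->
  Rabs (pairing y j E s v (sol t1 t2 E s v) - pairing y j E s v (sol t1 t2 0 0 0))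
    <= pairing_error * param_size E s v ^ 2.
Proof.
  intros Hy Ht Hsize.
  rewrite (pairing_minus mode_bound y sol_bound); trivial;
    [|now apply wbounded_sol|apply wbounded_sol; [trivial|exact param_size_0]].
  assert (Hdiff := sol_lipschitz t1 t2 E s v 0 0 0 Ht Hsize param_size_0).
  rewrite !Rminus_0_r in Hdiff.
  replace (pairing_error * param_size E s v ^ 2) with
    (mode_bound * (Lip * param_size E s v * (source_gain * param_size E s v))
     * Zsum (fun n => rho ^ Z.abs_nat n)) by (unfold pairing_error; ring).
  now apply Rabs_pairing_le.
Qed.

Definition residual (j : component) (t1 t2 s v E : R) : R :=
  - defect E s v j (sol t1 t2 E s v).

Lemma residual_Im1_near_pairing t1 t2 s v E : unit_seed t1 t2 -> param_size E s v <= param_radius ->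
  Rabs (residual Im1 t1 t2 s v E - pairing phi Im1 E s v (sol t1 t2 0 0 0))
    <= pairing_error * param_size E s v ^ 2.
Proof.
  intros Ht Hsize. unfold residual.
  rewrite (defect_Im1_eq_pairing E s v t1 t2 _ sol_bound
    (wbounded_sol t1 t2 E s v Ht Hsize) (sol_fixed_point t1 t2 E s v Ht Hsize)).
  apply pairing_sol_near_mode; trivial. exact decays_phi.
Qed.

Lemma residual_Re4_near_pairing t1 t2 s v E : unit_seed t1 t2 -> param_size E s v <= param_radius ->
  Rabs (residual Re4 t1 t2 s v E - pairing psi Re4 E s v (sol t1 t2 0 0 0))
    <= pairing_error * param_size E s v ^ 2.
Proof.
  intros Ht Hsize. unfold residual.
  rewrite (defect_Re4_eq_pairing E s v t1 t2 _ sol_bound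
    (wbounded_sol t1 t2 E s v Ht Hsize) (sol_fixed_point t1 t2 E s v Ht Hsize)).
  apply pairing_sol_near_mode; trivial. exact decays_psi.
Qed.

Lemma balance_row j n : exists r, forall x, balance j x n = row_eval r x.
Proof.
  destruct j; unfold balance, two_step, two_step_adjoint.
  - exists [(bn n, (Re1, n)); (cn (n - 1), (Re1, n - 1)%Z); (- mn (n - 2), (Re1, n - 2)%Z)].
    intros x. simpl. ring.
  - exists [(bn n, (Im1, n)); (- cn (n - 1), (Im1, n - 1)%Z)]. intros x. simpl. ring.
  - exists [(dn n, (Re2, n + 2)%Z); (2 * bn n, (Re1, n))]. intros x. simpl. ring.
  - exists [(bn n, (Re4, n)); (cn n, (Re4, n + 1)%Z); (- mn n, (Re4, n + 2)%Z)].
    intros x. simpl. ring.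
  - exists [(bn n, (Im4, n)); (- cn n, (Im4, n + 1)%Z)]. intros x. simpl. ring.
  - exists [(dn n, (Re5, n)); (2 * bn (n + 2), (Re4, n + 2)%Z)]. intros x. simpl. ring.
  - now exists [].
  - now exists [].
Qed.

Lemma residual_continuous j t1 t2 s v E : unit_seed t1 t2 -> param_size E s v < param_radius ->
  continuity_pt (residual j t1 t2 s v) E.
Proof.
  intros Ht Hsize.
  assert (cont : forall r, continuity_pt (fun E => row_eval r (sol t1 t2 E s v)) E).
  { intros r. apply continuity_pt_row_eval. intros i. now apply sol_continuous. }
  destruct (balance_row j 0) as [r Hr].
  apply continuity_pt_ext with (fun E => row_eval (source 0 s v j 0) (sol t1 t2 E s v)
    + E * row_eval (source 1 0 0 j 0) (sol t1 t2 E s v) - row_eval r (sol t1 t2 E s v)).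
  - intros E'. unfold residual, defect. rewrite Hr.
    destruct j; cbn [source row_eval fold_right fst snd]; ring.
  - apply continuity_pt_minus; [apply continuity_pt_plus|]; [apply cont| |apply cont].
    apply continuity_pt_mult; [apply continuity_pt_id|apply cont].
Qed.

Lemma residual_matrix_leading s v E : Rabs v <= Rabs s -> param_size E s v <= param_radius ->
  let err := 4 * pairing_error * (Rabs E + Rabs s) ^ 2 in
  Rabs (residual Im1 1 0 s v E - E * norm_phi) <= err /\
  Rabs (residual Im1 0 1 s v E - s * overlap) <= err /\
  Rabs (residual Re4 1 0 s v E - s * overlap) <= err /\
  Rabs (residual Re4 0 1 s v E - E * norm_psi) <= err.
Proof.
  intros Hv Hsize err.
  assert (Herr : pairing_error * param_size E s v ^ 2 <= err).
  { replace err with (pairing_error * (2 * (Rabs E + Rabs s)) ^ 2) by (unfold err; ring).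
    apply Rmult_le_compat_l; [exact pairing_error_nonneg|]. apply pow_incr.
    split; [apply param_size_nonneg|]. assert (H := Rabs_pos E). unfold param_size. lra. }
  rewrite <- (pairing_phi_mode_phi E s v), <- (pairing_phi_mode_psi E s v) at 1.
  rewrite <- (pairing_psi_mode_phi E s v), <- (pairing_psi_mode_psi E s v).
  repeat split; apply Rle_trans with (2 := Herr);
    [apply residual_Im1_near_pairing|apply residual_Im1_near_pairing
    |apply residual_Re4_near_pairing|apply residual_Re4_near_pairing];
    auto using unit_seed_10, unit_seed_01.
Qed.

Lemma singular_residual_decaying_solution s v E : param_size E s v <= param_radius ->
  residual Im1 1 0 s v E * residual Re4 0 1 s v E
    - residual Im1 0 1 s v E * residual Re4 1 0 s v E = 0 ->
  exists x, decaying_solution rho E (1 - v) s x.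
Proof.
  intros Hsize Hdet. destruct (singular_2x2_kernel _ _ _ _ Hdet) as [t1 [t2 [Ht [Hker1 Hker4]]]].
  assert (Hfix := sweep_fixed_point_combination E s v t1 t2 _ _
    (sol_fixed_point 1 0 E s v unit_seed_10 Hsize) (sol_fixed_point 0 1 E s v unit_seed_01 Hsize)).
  exists (fun i => t1 * sol 1 0 E s v i + t2 * sol 0 1 E s v i). split; [|split].
  - exists ((Rabs t1 + Rabs t2) * mode_bound). intros j n.
    assert (decays_10 := wbounded_decays _ _ j (wbounded_sol 1 0 E s v unit_seed_10 Hsize) n).
    assert (decays_01 := wbounded_decays _ _ j (wbounded_sol 0 1 E s v unit_seed_01 Hsize) n).
    eapply Rle_trans; [apply Rabs_triang|]. rewrite !Rabs_mult.
    rewrite Rmult_assoc, Rmult_plus_distr_r.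
    apply Rplus_le_compat; apply Rmult_le_compat_l; trivial; apply Rabs_pos.
  - apply fixed_point_real_system with (1 := Hfix); rewrite defect_linear;
      unfold residual in *; lra.
  - destruct Ht as [Ht|Ht]; [left|right].
    + now rewrite (fixed_point_Im4_0 _ _ _ _ _ _ Hfix).
    + now rewrite (fixed_point_Re1_0 _ _ _ _ _ _ Hfix).
Qed.

Lemma decaying_solution_branch : exists e s0 L : R, 0 < e /\ 0 < s0 /\ 0 < L /\
  forall s v, 0 < Rabs s < s0 -> Rabs v <= Rabs s ->
  exists E x, Rabs (E - e * Rabs s) <= L * s ^ 2 /\ decaying_solution rho E (1 - v) s x.
Proof.
  assert (Hr := param_radius_pos). assert (Herr := pairing_error_nonneg).
  destruct (perturbed_det_root norm_phi norm_psi overlap overlap (4 * pairing_error)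
    (param_radius / 2))
    as [e [s0 [L [He [Hs0 [HL Hroot]]]]]];
    auto using norm_phi_pos, norm_psi_pos, overlap_pos; try lra.
  exists e, (Rmin s0 (param_radius / 4)), L.
  split; [trivial|]. split; [apply Rmin_glb_lt; lra|]. split; [trivial|].
  intros s v [Hs Hsmin] Hv.
  assert (Hs1 := Rlt_le_trans _ _ _ Hsmin (Rmin_l _ _)).
  assert (Hs2 := Rlt_le_trans _ _ _ Hsmin (Rmin_r _ _)).
  assert (Hsize : forall E, Rabs E < param_radius / 2 -> param_size E s v < param_radius)
    by (intros; unfold param_size; lra).
  destruct (Hroot s (residual Im1 1 0 s v) (residual Im1 0 1 s v) (residual Re4 1 0 s v)
    (residual Re4 0 1 s v)) as [E [HE [HEs Hdet]]].
  - now split.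
  - intros E HE. apply residual_matrix_leading; [trivial|now apply Rlt_le, Hsize].
  - intros E HE. apply continuity_pt_minus; apply continuity_pt_mult; apply residual_continuous;
      auto using unit_seed_10, unit_seed_01.
  - destruct (singular_residual_decaying_solution s v E) as [x Hx];
      [now apply Rlt_le, Hsize|trivial|].
    now exists E, x.
Qed.

End Weights.

End RealSystem.

(** * Existence of the decaying solutions *)

Lemma characteristic_roots b c : 0 < b < c -> exists zeta omega,
  0 < zeta < 1 /\ -1 < omega < 0 /\ c * omega = - b * (1 + zeta * omega) /\
  2 * b * b / c * omega = - b * zeta.
Proof.
  intros [Hb Hc]. set (m := 2 * b * b / c).
  assert (Hm : 0 < m) by (apply Rdiv_lt_0_compat; nra).
  assert (Hmbc : m < b + c) by (unfold m; apply Rlt_div_l; nra).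
  set (D := c * c + 4 * b * m).
  assert (HD : sqrt D * sqrt D = D) by (apply sqrt_sqrt; unfold D; nra).
  assert (Hs : c < sqrt D).
  { assert (H := sqrt_pos D). apply Rnot_le_lt. intros Hle. unfold D in *. nra. }
  set (zeta := (sqrt D - c) / (2 * b)).
  assert (Hzeta : 0 < zeta) by (apply Rdiv_lt_0_compat; lra).
  assert (Hroot : b * zeta * zeta + c * zeta = m).
  { transitivity ((sqrt D * sqrt D - c * c) / (4 * b)); [unfold zeta; field; lra|].
    rewrite HD. unfold D. field. lra. }
  assert (Hbz : 0 < b * zeta < c * zeta) by (split; [nra|now apply Rmult_lt_compat_r]).
  assert (Hbzz : 0 < b * zeta * zeta) by (apply Rmult_lt_0_compat; lra).
  assert (Hzeta1 : zeta < 1).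
  { apply Rnot_le_lt. intros Hle. assert (b <= b * zeta * zeta) by nra.
    assert (c <= c * zeta) by nra. lra. }
  exists zeta, (- b * zeta / m). repeat split; trivial.
  - apply Rlt_div_r; lra.
  - apply Rlt_div_l; lra.
  - apply Rmult_eq_reg_r with m; [|lra].
    transitivity (- b * (c * zeta)); [field; lra|].
    replace (c * zeta) with (m - b * zeta * zeta) by lra. field. lra.
  - fold m. field. lra.
Qed.

Lemma coef_uniform_bound bp bm dp dm c :
  0 < bp -> 0 < bm -> 0 < bp + dp -> 0 < bm + dm -> 0 < c ->
  exists B, 2 <= B /\ forall n, / B <= coef_b bp bm n <= B /\
    / B <= coef_c bp bm dp dm c n <= B /\ / B <= coef_d bp bm dp dm c n <= B.
Proof.
  intros Hbp Hbm Hcp Hcm Hc.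
  assert (Ibp := Rinv_0_lt_compat _ Hbp). assert (Ibm := Rinv_0_lt_compat _ Hbm).
  assert (Icp := Rinv_0_lt_compat _ Hcp). assert (Icm := Rinv_0_lt_compat _ Hcm).
  assert (Ic := Rinv_0_lt_compat _ Hc).
  set (B := 2 + bp + bm + (bp + dp) + (bm + dm) + c
            + / bp + / bm + / (bp + dp) + / (bm + dm) + / c).
  assert (between : forall u, 0 < u -> u <= B -> / u <= B -> / B <= u <= B).
  { intros u Hu HuB HiB. split; [|trivial]. rewrite <- (Rinv_inv u).
    apply Rinv_le_contravar; [now apply Rinv_0_lt_compat|trivial]. }
  exists B. split; [unfold B; lra|]. intros n. unfold coef_b, coef_c, coef_d.
  destruct (Z.leb 0 n), (Z.eqb n (-1)), (Z.leb (-2) n);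
    split; try split; apply between; unfold B; lra.
Qed.

Lemma common_decay_rate t1 t2 t3 t4 : t1 < 1 -> t2 < 1 -> t3 < 1 -> 0 < t4 < 1 ->
  exists rho, 0 < rho < 1 /\ t1 <= rho ^ 4 /\ t2 <= rho ^ 4 /\ t3 <= rho ^ 4 /\ t4 <= rho ^ 4.
Proof.
  intros lt1 lt2 lt3 range4. set (t := Rmax (Rmax t1 t2) (Rmax t3 t4)).
  assert (Ht1 : t1 <= t) by (eapply Rle_trans; [apply Rmax_l|apply Rmax_l]).
  assert (Ht2 : t2 <= t) by (eapply Rle_trans; [apply Rmax_r|apply Rmax_l]).
  assert (Ht3 : t3 <= t) by (eapply Rle_trans; [apply Rmax_l|apply Rmax_r]).
  assert (Ht4 : t4 <= t) by (eapply Rle_trans; [apply Rmax_r|apply Rmax_r]).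
  assert (Ht : t < 1) by (unfold t; repeat apply Rmax_lub_lt; lra).
  assert (Hpow : sqrt (sqrt t) ^ 4 = t).
  { replace (sqrt (sqrt t) ^ 4) with ((sqrt (sqrt t) ^ 2) ^ 2) by ring.
    rewrite !pow2_sqrt; [reflexivity|lra|apply sqrt_pos]. }
  exists (sqrt (sqrt t)). rewrite Hpow. repeat split; trivial.
  - apply sqrt_lt_R0, sqrt_lt_R0. lra.
  - assert (sqrt_lt : forall x, 0 <= x < 1 -> sqrt x < 1)
      by (intros x Hx; rewrite <- sqrt_1; now apply sqrt_lt_1_alt).
    apply sqrt_lt. split; [apply sqrt_pos|apply sqrt_lt; lra].
Qed.

Lemma interface_branch bp bm dp dm c :
  0 < bp -> 0 < bm -> 0 < bm + dm -> 0 < dp -> dm < 0 -> 0 < c ->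
  exists rho e s0 L : R, 0 < rho < 1 /\ 0 < e /\ 0 < s0 /\ 0 < L /\
  forall s v, 0 < Rabs s < s0 -> Rabs v <= Rabs s ->
  exists E x, Rabs (E - e * Rabs s) <= L * s ^ 2 /\
    decaying_solution bp bm dp dm c rho E (1 - v) s x.
Proof.
  intros Hbp Hbm Hcm Hdp Hdm Hc. assert (Hcp : 0 < bp + dp) by lra.
  destruct (characteristic_roots bp (bp + dp)) as [zeta [omega [Hz [Ho [Hsum Hprod]]]]]; [lra|].
  destruct (coef_uniform_bound bp bm dp dm c) as [B [HB HBn]]; trivial.
  assert (right_lt_1 : bp / (bp + dp) < 1) by (apply Rlt_div_l; lra).
  assert (left_lt_1 : (bm + dm) / bm < 1) by (apply Rlt_div_l; lra).
  destruct (common_decay_rate (bp / (bp + dp)) ((bm + dm) / bm) (- omega) zeta)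
    as [rho [Hrho [Hr1 [Hr2 [Hr3 Hr4]]]]]; try lra.
  exists rho.
  destruct (decaying_solution_branch bp bm dp dm c zeta omega Hbp Hbm Hcp Hcm Hc Hz Ho Hsum Hprod
    rho B Hrho HB Hr1 Hr2 Hr4 Hr3) as [e [s0 [L Hbranch]]];
    try (intros n; apply HBn).
  now exists e, s0, L.
Qed.

(** * From the real system to the Bloch Hamiltonian *)

Lemma cexpi_add a b : cexpi (a + b) = Cmult (cexpi a) (cexpi b).
Proof. unfold cexpi, Cmult. simpl. rewrite cos_plus, sin_plus. f_equal. ring. Qed.

Lemma Cmod_cexpi a : Cmod (cexpi a) = 1.
Proof.
  unfold Cmod, cexpi. simpl fst. simpl snd.
  rewrite <- !Rsqr_pow2, Rplus_comm, sin2_cos2. apply sqrt_1.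
Qed.

Lemma in_l2_Zsummable w :
  (forall j, valid_index j -> Zsummable (fun n => Cmod (w j n) ^ 2)) -> in_l2 w.
Proof.
  intros Hw j Hj. destruct (Hw j Hj) as [Hr Hl]. split; now apply ex_series_Rabs.
Qed.

Lemma in_l2_Cmod_eq u w : (forall j n, Cmod (w j n) = Cmod (u j n)) -> in_l2 u -> in_l2 w.
Proof.
  intros Huw Hu j Hj. destruct (Hu j Hj) as [Hr Hl].
  split; [apply ex_series_ext with (2 := Hr)|apply ex_series_ext with (2 := Hl)];
    intros m; now rewrite Huw.
Qed.

Lemma nonzero_vec_Cmod_eq u w : (forall j n, Cmod (w j n) = Cmod (u j n)) ->
  nonzero_vec u -> nonzero_vec w.
Proof.
  intros Huw [j [n [Hj Hn]]]. exists j, n. split; [trivial|].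
  apply Cmod_gt_0. rewrite Huw. now apply Cmod_gt_0.
Qed.

Section Hamiltonian.

Variables bp bm dp dm c : R.

Local Notation bn n := (RtoC (coef_b bp bm n)).
Local Notation cn n := (RtoC (coef_c bp bm dp dm c n)).
Local Notation dn n := (RtoC (coef_d bp bm dp dm c n)).
Local Notation H := (H_II bp bm dp dm c).
Local Notation is_eigenvalue := (is_eigenvalue_II bp bm dp dm c).

Lemma valid_index_cases j : valid_index j ->
  j = 1%nat \/ j = 2%nat \/ j = 3%nat \/ j = 4%nat \/ j = 5%nat \/ j = 6%nat.
Proof. unfold valid_index. lia. Qed.

Definition gauge (th : R) (u : vec) : vec := fun j n => Cmult (cexpi (th * IZR n)) (u j n).

(* The Bloch phase spread evenly over the two bonds with coefficient [c_n]. *)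
Definition gauged_H (th : R) (u : vec) : vec := fun j n => (
  let u1 := u 1%nat in let u2 := u 2%nat in let u3 := u 3%nat in
  let u4 := u 4%nat in let u5 := u 5%nat in let u6 := u 6%nat in
  match j with
  | 1%nat => - (bn n * u4 n + bn n * u5 n + cn n * (cexpi (- th) * u6 (n + 1)%Z))
  | 2%nat => - (bn n * u4 n + dn (n - 2)%Z * u5 (n - 2)%Z + bn n * u6 n)
  | 3%nat => - (cn n * (cexpi th * u4 (n + 1)%Z) + bn n * u5 n + bn n * u6 n)
  | 4%nat => - (bn n * u1 n + bn n * u2 n + cn (n - 1)%Z * (cexpi (- th) * u3 (n - 1)%Z))
  | 5%nat => - (bn n * u1 n + dn n * u2 (n + 2)%Z + bn n * u3 n)
  | 6%nat => - (cn (n - 1)%Z * (cexpi th * u1 (n - 1)%Z) + bn n * u2 n + bn n * u3 n)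
  | _ => 0
  end)%C.

Lemma cexpi_gauge th t t' i n : t + th * IZR i = t' ->
  Cmult (cexpi t) (cexpi (th * IZR (n + i))) = Cmult (cexpi (th * IZR n)) (cexpi t').
Proof. intros <-. rewrite <- !cexpi_add, plus_IZR. f_equal. ring. Qed.

Lemma H_II_gauge th u j n : valid_index j ->
  H (2 * th) (gauge th u) j n = Cmult (cexpi (th * IZR n)) (gauged_H th u j n).
Proof.
  intros Hj.
  assert (succ_phase := cexpi_gauge th (- (2 * th)) (- th) 1 n ltac:(ring)).
  assert (pred_phase := cexpi_gauge th (2 * th) th (-1) n ltac:(ring)).
  assert (succ2_phase := cexpi_gauge th (- (2 * th)) 0 2 n ltac:(ring)).
  assert (pred2_phase := cexpi_gauge th (2 * th) 0 (-2) n ltac:(ring)).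
  assert (succ_no_phase := cexpi_gauge th 0 th 1 n ltac:(ring)).
  assert (pred_no_phase := cexpi_gauge th 0 (- th) (-1) n ltac:(ring)).
  change (n + -1)%Z with (n - 1)%Z in *. change (n + -2)%Z with (n - 2)%Z in *.
  assert (one : cexpi 0 = 1%C) by (unfold cexpi; now rewrite cos_0, sin_0).
  rewrite one in *. rewrite Cmult_1_l in succ_no_phase, pred_no_phase.
  rewrite Cmult_1_r in succ2_phase, pred2_phase.
  assert (assoc : forall x y z w : C, (x * y * (z * w) = x * (y * z) * w)%C) by (intros; ring).
  destruct (valid_index_cases j Hj) as [-> |[-> |[-> |[-> |[-> | ->]]]]];
    unfold H_II, gauge, gauged_H; rewrite ?assoc.
  - rewrite succ_phase. ring.
  - rewrite pred2_phase. ring.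
  - rewrite succ_no_phase. ring.
  - rewrite pred_no_phase. ring.
  - rewrite succ2_phase. ring.
  - rewrite pred_phase. ring.
Qed.

(* [w_4] and [w_6], as well as [w_1] and [w_3], are complex conjugates up to the gauge. *)
Definition complexify (x : state) : vec := fun j n =>
  match j with
  | 1%nat => (x (Re1, n), x (Im1, n))
  | 2%nat => (x (Re2, n), 0)
  | 3%nat => (x (Re1, n), - x (Im1, n))
  | 4%nat => (x (Re4, n), x (Im4, n))
  | 5%nat => (x (Re5, n), 0)
  | 6%nat => (x (Re4, n), - x (Im4, n))
  | _ => RtoC 0
  end.

Lemma gauged_H_complexify E th x j n : valid_index j ->
  real_system bp bm dp dm c E (cos th) (sin th) x ->
  gauged_H th (complexify x) j n = Cmult (RtoC (- E)) (complexify x j n).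
Proof.
  intros Hj Hx. destruct (Hx n) as [eq_Re1 [eq_Im1 [eq_Re2 [eq_Re4 [eq_Im4 eq_Re5]]]]].
  destruct (valid_index_cases j Hj) as [-> |[-> |[-> |[-> |[-> | ->]]]]];
    unfold gauged_H, complexify, Cmult, Cplus, Copp, RtoC, cexpi; simpl;
    rewrite ?cos_neg, ?sin_neg; f_equal; lra.
Qed.

Lemma in_l2_complexify rho M x : 0 < rho < 1 ->
  (forall j, decays rho M (fun n => x (j, n))) -> in_l2 (complexify x).
Proof.
  intros Hrho Hx. apply in_l2_Zsummable. intros j Hj.
  assert (square : forall i, Zsummable (fun n => x (i, n) ^ 2))
    by (intros i; exact (decays_Zsummable_pow2 rho Hrho M _ (Hx i))).
  assert (modulus : forall i i', Zsummable (fun n => x (i, n) ^ 2 + x (i', n) ^ 2))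
    by (intros; now apply Zsummable_plus).
  destruct (valid_index_cases j Hj) as [-> |[-> |[-> |[-> |[-> | ->]]]]];
    [apply Zsummable_ext with (2 := modulus Re1 Im1)
    |apply Zsummable_ext with (2 := square Re2)
    |apply Zsummable_ext with (2 := modulus Re1 Im1)
    |apply Zsummable_ext with (2 := modulus Re4 Im4)
    |apply Zsummable_ext with (2 := square Re5)
    |apply Zsummable_ext with (2 := modulus Re4 Im4)];
    intros n; rewrite Cmod2_alt; simpl; ring.
Qed.

Lemma nonzero_vec_complexify x : x (Im4, 0%Z) <> 0 \/ x (Re1, 0%Z) <> 0 ->
  nonzero_vec (complexify x).
Proof.
  intros [Hx|Hx]; [exists 4%nat, 0%Z|exists 1%nat, 0%Z];
    (split; [unfold valid_index; lia|]); intros Heq; injection Heq; contradiction.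
Qed.

Lemma Cmod_gauge th u j n : Cmod (gauge th u j n) = Cmod (u j n).
Proof. unfold gauge. rewrite Cmod_mult, Cmod_cexpi. ring. Qed.

Lemma decaying_solution_eigenvalue rho E th x : 0 < rho < 1 ->
  decaying_solution bp bm dp dm c rho E (cos th) (sin th) x -> is_eigenvalue (2 * th) (- E).
Proof.
  intros Hrho [[M Hdec] [Hsys Hnz]]. exists (gauge th (complexify x)). split; [|split].
  - apply in_l2_Cmod_eq with (1 := Cmod_gauge th _). now apply in_l2_complexify with rho M.
  - apply nonzero_vec_Cmod_eq with (1 := Cmod_gauge th _). now apply nonzero_vec_complexify.
  - intros j n Hj. rewrite H_II_gauge, gauged_H_complexify with (E := E) by trivial.
    unfold gauge. ring.
Qed.

(** * Chiral and reflection symmetries *)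

Definition chirality (w : vec) : vec := fun j n => if Nat.leb j 3 then Copp (w j n) else w j n.

Lemma Cmod_chirality w j n : Cmod (chirality w j n) = Cmod (w j n).
Proof. unfold chirality. destruct (Nat.leb j 3); [apply Cmod_opp|reflexivity]. Qed.

Lemma H_II_chirality k w j n : valid_index j ->
  H k (chirality w) j n = Copp (chirality (H k w) j n).
Proof.
  intros Hj. destruct (valid_index_cases j Hj) as [-> |[-> |[-> |[-> |[-> | ->]]]]];
    unfold H_II, chirality; simpl; ring.
Qed.

Lemma is_eigenvalue_II_opp k E : is_eigenvalue k E -> is_eigenvalue k (- E).
Proof.
  intros [w [Hl2 [Hnz Hw]]]. exists (chirality w). split; [|split].
  - now apply in_l2_Cmod_eq with (1 := Cmod_chirality w).
  - now apply nonzero_vec_Cmod_eq with (1 := Cmod_chirality w).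
  - intros j n Hj. rewrite H_II_chirality by trivial. unfold chirality.
    rewrite Hw, RtoC_opp by trivial. destruct (Nat.leb j 3); ring.
Qed.

End Hamiltonian.

Definition reflection (w : vec) : vec := fun j n => w (7 - j)%nat (- n - 1)%Z.

Lemma valid_index_reflect j : valid_index j -> valid_index (7 - j).
Proof. unfold valid_index. lia. Qed.

Lemma in_l2_reflection w : in_l2 w -> in_l2 (reflection w).
Proof.
  intros Hw j Hj. destruct (Hw _ (valid_index_reflect j Hj)) as [Hr Hl]. split; [exact Hl|].
  apply ex_series_ext with (2 := Hr). intros m. unfold reflection. do 3 f_equal. lia.
Qed.

Lemma nonzero_vec_reflection w : nonzero_vec w -> nonzero_vec (reflection w).
Proof.
  intros [j [n [Hj Hn]]]. exists (7 - j)%nat, (- n - 1)%Z.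
  split; [now apply valid_index_reflect|]. unfold reflection, valid_index in *.
  replace (7 - (7 - j))%nat with j by lia. now replace (- (- n - 1) - 1)%Z with n by lia.
Qed.

Lemma coef_b_reflect bp bm n : coef_b bp bm n = coef_b bm bp (- n - 1).
Proof.
  unfold coef_b. now destruct (Z.leb_spec 0 n), (Z.leb_spec 0 (- n - 1)); try lia.
Qed.

Lemma coef_c_reflect bp bm dp dm c n : coef_c bp bm dp dm c n = coef_c bm bp dm dp c (- n - 2).
Proof.
  unfold coef_c.
  now destruct (Z.leb_spec 0 n), (Z.leb_spec 0 (- n - 2)), (Z.eqb_spec n (-1)),
    (Z.eqb_spec (- n - 2) (-1)); try lia.
Qed.

Lemma coef_d_reflect bp bm dp dm c n : coef_d bp bm dp dm c n = coef_d bm bp dm dp c (- n - 3).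
Proof.
  unfold coef_d.
  now destruct (Z.leb_spec 0 n), (Z.leb_spec 0 (- n - 3)), (Z.leb_spec (-2) n),
    (Z.leb_spec (-2) (- n - 3)); try lia.
Qed.

Lemma H_II_reflection bp bm dp dm c k w j n : valid_index j ->
  H_II bp bm dp dm c k (reflection w) j n = reflection (H_II bm bp dm dp c (- k) w) j n.
Proof.
  intros Hj.
  assert (site_succ : (- (n + 1) - 1 = - n - 1 - 1)%Z) by lia.
  assert (site_pred : (- (n - 1) - 1 = - n - 1 + 1)%Z) by lia.
  assert (site_succ2 : (- (n + 2) - 1 = - n - 1 - 2)%Z) by lia.
  assert (site_pred2 : (- (n - 2) - 1 = - n - 1 + 2)%Z) by lia.
  assert (bond_c : (- n - 2 = - n - 1 - 1)%Z) by lia.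
  assert (bond_c_pred : (- (n - 1) - 2 = - n - 1)%Z) by lia.
  assert (bond_d : (- n - 3 = - n - 1 - 2)%Z) by lia.
  assert (bond_d_pred2 : (- (n - 2) - 3 = - n - 1)%Z) by lia.
  destruct (valid_index_cases j Hj) as [-> |[-> |[-> |[-> |[-> | ->]]]]];
    unfold H_II, reflection; simpl Nat.sub; cbv iota beta zeta;
    rewrite (coef_b_reflect bp bm), ?(coef_c_reflect bp bm), ?(coef_d_reflect bp bm),
      ?Ropp_involutive, ?site_succ, ?site_pred, ?site_succ2, ?site_pred2, ?bond_c,
      ?bond_c_pred, ?bond_d, ?bond_d_pred2; ring.
Qed.

Lemma is_eigenvalue_II_reflect bp bm dp dm c k E :
  is_eigenvalue_II bm bp dm dp c (- k) E -> is_eigenvalue_II bp bm dp dm c k E.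
Proof.
  intros [w [Hl2 [Hnz Hw]]]. exists (reflection w).
  split; [now apply in_l2_reflection|]. split; [now apply nonzero_vec_reflection|].
  intros j n Hj. rewrite H_II_reflection by trivial.
  unfold reflection. now apply Hw, valid_index_reflect.
Qed.

(** * Dispersion relation *)

Lemma abs_sin_bounds th : Rabs th <= PI / 2 -> th <> 0 ->
  0 < Rabs (sin th) <= Rabs th /\ Rabs th - Rabs (sin th) <= th ^ 2 /\
  0 <= 1 - cos th <= Rabs (sin th).
Proof.
  assert (Hpos : forall t, 0 < t <= PI / 2 ->
    0 < sin t <= t /\ t - sin t <= t ^ 2 /\ 0 <= 1 - cos t <= sin t).
  { intros t Ht. assert (HPI4 := PI_4).
    assert (Hs : 0 < sin t) by (apply sin_gt_0; lra).
    assert (Hc : 0 <= cos t) by (apply cos_ge_0; lra).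
    assert (Hc1 := COS_bound t). assert (Hs1 := SIN_bound t).
    assert (Hsc := sin2_cos2 t). unfold Rsqr in Hsc.
    assert (Hlt : sin t < t) by (apply sin_lt_x; lra).
    destruct (pre_sin_bound t 0) as [Hlow _]; [lra|lra|].
    unfold sin_approx, sin_term in Hlow. simpl in Hlow.
    repeat split; try lra; [|nra].
    assert (t * t * t / 6 <= t * t) by nra. simpl. lra. }
  intros Hth Hn0. destruct (Rle_or_lt 0 th) as [Hsgn|Hsgn].
  - rewrite (Rabs_pos_eq th) in * by lra. destruct (Hpos th) as [Hsin [Hdiff Hcos]]; [lra|].
    rewrite Rabs_pos_eq by lra. repeat split; lra.
  - rewrite (Rabs_left th) in * by lra. destruct (Hpos (- th)) as [Hsin [Hdiff Hcos]]; [lra|].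
    rewrite sin_neg in *. rewrite cos_neg in *. rewrite Rabs_left by lra.
    replace (th ^ 2) with ((- th) ^ 2) by ring. repeat split; lra.
Qed.

Lemma half_angle_dispersion E e L th : 0 < e -> 0 <= L -> Rabs th <= PI / 2 -> th <> 0 ->
  Rabs (E - e * Rabs (sin th)) <= L * sin th ^ 2 ->
  Rabs (E - e / 2 * Rabs (2 * th)) <= (L + e) * (2 * th) ^ 2.
Proof.
  intros He HL Hth Hn0 HE. destruct (abs_sin_bounds th Hth Hn0) as [Hsin [Hdiff _]].
  rewrite Rabs_mult, (Rabs_pos_eq 2) by lra.
  replace (E - e / 2 * (2 * Rabs th)) with
    ((E - e * Rabs (sin th)) + - (e * (Rabs th - Rabs (sin th)))) by field.
  eapply Rle_trans; [apply Rabs_triang|]. rewrite Rabs_Ropp, (Rabs_pos_eq (e * _)) by nra.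
  assert (Hsq : sin th ^ 2 <= th ^ 2).
  { rewrite <- (pow2_abs (sin th)), <- (pow2_abs th). apply pow_incr. lra. }
  assert (Hq : 0 <= th ^ 2) by apply pow2_ge_0.
  assert (L * sin th ^ 2 <= L * th ^ 2) by (now apply Rmult_le_compat_l).
  assert (e * (Rabs th - Rabs (sin th)) <= e * th ^ 2) by (apply Rmult_le_compat_l; lra).
  assert (0 <= (L + e) * th ^ 2) by (apply Rmult_le_pos; lra).
  replace ((L + e) * (2 * th) ^ 2) with (4 * ((L + e) * th ^ 2)) by ring. lra.
Qed.

Definition has_symmetric_branch (bp bm dp dm c E1 : R) : Prop :=
  exists k0 : R, 0 < k0 /\ exists K : R, forall k : R, Rabs k <= PI -> 0 < Rabs k < k0 ->
    exists E : R, 0 < E /\ is_eigenvalue_II bp bm dp dm c k E /\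
      is_eigenvalue_II bp bm dp dm c k (- E) /\ Rabs (E - E1 * Rabs k) <= K * k ^ 2.

Lemma symmetric_branch_right bp bm dp dm c :
  0 < bp -> 0 < bm -> 0 < bm + dm -> 0 < dp -> dm < 0 -> 0 < c ->
  exists E1, 0 < E1 /\ has_symmetric_branch bp bm dp dm c E1.
Proof.
  intros Hbp Hbm Hcm Hdp Hdm Hc.
  destruct (interface_branch bp bm dp dm c) as [rho [e [s0 [L [Hrho [He [Hs0 [HL Hbranch]]]]]]]];
    trivial.
  exists (e / 2). split; [lra|].
  exists (Rmin s0 (e / L)). split; [apply Rmin_glb_lt; [|apply Rdiv_lt_0_compat]; trivial|].
  exists (L + e). intros k Hk Hk0.
  assert (Hks := Rlt_le_trans _ _ _ (proj2 Hk0) (Rmin_l _ _)).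
  assert (HkL := Rlt_le_trans _ _ _ (proj2 Hk0) (Rmin_r _ _)).
  apply Rlt_div_r in HkL; [|trivial].
  replace k with (2 * (k / 2)) in * by field. set (th := k / 2) in *.
  rewrite (Rabs_mult 2 th), (Rabs_pos_eq 2) in Hk, Hk0, Hks, HkL by lra.
  assert (Hth0 : th <> 0) by (intros H0; rewrite H0, Rabs_R0 in Hk0; lra).
  destruct (abs_sin_bounds th) as [Hsin [_ Hcos]]; [lra|trivial|].
  destruct (Hbranch (sin th) (1 - cos th)) as [E [x [HE Hx]]]; [lra|rewrite Rabs_pos_eq; lra|].
  replace (1 - (1 - cos th)) with (cos th) in Hx by ring.
  assert (Hminus := decaying_solution_eigenvalue bp bm dp dm c rho E th x Hrho Hx).
  exists E. split; [|split; [|split; [exact Hminus|]]].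
  - assert (L * Rabs (sin th) <= L * Rabs th) by (apply Rmult_le_compat_l; lra).
    assert (HsL : L * Rabs (sin th) * Rabs (sin th) < e * Rabs (sin th))
      by (apply Rmult_lt_compat_r; lra).
    replace (L * Rabs (sin th) * Rabs (sin th)) with (L * sin th ^ 2) in HsL
      by (rewrite <- (pow2_abs (sin th)); ring).
    apply Rabs_le_between in HE. lra.
  - rewrite <- (Ropp_involutive E). now apply is_eigenvalue_II_opp.
  - apply half_angle_dispersion; trivial; lra.
Qed.

Lemma symmetric_branch_reflect bp bm dp dm c E1 :
  has_symmetric_branch bm bp dm dp c E1 -> has_symmetric_branch bp bm dp dm c E1.
Proof.
  intros [k0 [Hk0 [K HK]]]. exists k0. split; [trivial|]. exists K. intros k Hk Hkk.
  destruct (HK (- k)) as [E HE]; try (rewrite Rabs_Ropp; trivial).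
  rewrite Rabs_Ropp in HE. replace ((- k) ^ 2) with (k ^ 2) in HE by ring.
  destruct HE as [HEpos [Hplus [Hminus HE]]].
  exists E. auto using is_eigenvalue_II_reflect.
Qed.

Theorem theorem15 (bp bm dp dm c : R)
  (hbp : 0 < bp) (hbm : 0 < bm)
  (hdp : 0 < bp + dp) (hdm : 0 < bm + dm)
  (hdd : dp * dm < 0) (hc : 0 < c) :
  exists E1 : R, E1 <> 0 /\
  exists k0 : R, 0 < k0 /\
  exists K : R,
    forall k : R, - PI <= k < PI -> 0 < Rabs k < k0 ->
      exists Ep Em : R,
        Ep <> Em /\
        is_eigenvalue_II bp bm dp dm c k Ep /\
        is_eigenvalue_II bp bm dp dm c k Em /\
        Rabs (Ep - E1 * Rabs k) <= K * k ^ 2 /\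
        Rabs (Em - (- E1 * Rabs k)) <= K * k ^ 2.
Proof.
  assert (branch : exists E1, 0 < E1 /\ has_symmetric_branch bp bm dp dm c E1).
  { destruct (Rlt_or_le 0 dp) as [Hp|Hp].
    - apply symmetric_branch_right; trivial. nra.
    - destruct (symmetric_branch_right bm bp dm dp c) as [E1 [HE1 Hbranch]]; trivial; try nra.
      exists E1. split; [trivial|now apply symmetric_branch_reflect]. }
  destruct branch as [E1 [HE1 [k0 [Hk0 [K HK]]]]].
  exists E1. split; [lra|]. exists k0. split; [trivial|]. exists K.
  intros k Hk Hkk.
  destruct (HK k) as [E [HE [Hplus [Hminus Hdisp]]]]; [apply Rabs_le; lra|trivial|].
  exists E, (- E). split; [lra|]. repeat split; trivial.
  replace (- E - - E1 * Rabs k) with (- (E - E1 * Rabs k)) by ring. now rewrite Rabs_Ropp.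
Qed.
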